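(* Let $n\geq2$, let $\lambda_1,\ldots,\lambda_{n-1}\in\mathbb{R}\setminus\{0\}$ and $\alpha\in\mathbb{R}$ be constants, $I$ an open interval in $\mathbb{R}$, and let $\theta:I\to\mathbb{R}$ or $\theta:I\to\mathbb{R}/2\pi\mathbb{Z}$, $w_1,\ldots,w_{n-1}:I\to\mathbb{C}\setminus\{0\}$ and $\beta:I\to\mathbb{C}$ be smooth functions. Suppose that $$\frac{dw_j}{ds}=\lambda_je^{i\theta(s)}\,\overline{w_1\cdots w_{j-1}w_{j+1}\cdots w_{n-1}},\ \ j=1,\ldots,n-1,\qquad \frac{d\theta}{ds}=\alpha\,\mathrm{Im}\bigl(e^{-i\theta}w_1\cdots w_{n-1}\bigr),\qquad \frac{d\beta}{ds}=e^{i\theta(s)}\,\overline{w_1\cdots w_{n-1}}$$ hold in $I$. Then the submanifold $L$ of $\mathbb{C}^n$ given by $$L=\Bigl\{\bigl(x_1w_1(s),\ldots,x_{n-1}w_{n-1}(s),\,-\tfrac12\sum_{j=1}^{n-1}\lambda_jx_j^2+\beta(s)\bigr):x_1,\ldots,x_{n-1}\in\mathbb{R},\ s\in I\Bigr\}$$ is an embedded Lagrangian diffeomorphic to $\mathbb{R}^n$, with Lagrangian angle $\theta(s)$. When $\alpha\neq0$, it is a Lagrangian translating soliton with translating vector $(0,\ldots,0,\alpha)\in\mathbb{C}^n$. When $\alpha=0$, it is special Lagrangian.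
   Context: $\mathbb{C}^n$ has coordinates $z_j=x_j+iy_j$, the Euclidean metric, and $\omega=\sum_jdx_j\wedge dy_j$. An $n$-dimensional submanifold $L$ is Lagrangian if $\omega|_L=0$; its Lagrangian angle $\theta$ (for a suitable orientation) is defined by $dz_1\wedge\cdots\wedge dz_n|_L=e^{i\theta}\mathrm{vol}_L$; it is special Lagrangian if $\theta$ is constant. A submanifold $L$ is a translating soliton with translating vector $T$ (a constant vector) if $H\equiv T^\perp$ on $L$, where $H$ is the mean curvature vector and $T^\perp$ is the component of $T$ normal to $L$. Empty products are $1$. *)

(* Defs.v *)
(* C^n is represented by its real coordinates (x_1,...,x_n,y_1,...,y_n), i.e. by
   'rV[R]_(n + n), so that the real-analytic notions (differentiability,
   Jacobians, open sets) of the library apply directly; [zcoord] and [ofC] convert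
   to and from complex coordinates z_j = x_j + i y_j. *)
From HB Require Import structures.
From mathcomp Require Import all_boot all_order all_algebra.
From mathcomp Require Import generic_quotient ring_quotient.
From mathcomp Require Import complex.
From mathcomp Require Import all_classical all_reals all_analysis.

Set Implicit Arguments.
Unset Strict Implicit.
Unset Printing Implicit Defensive.

Import Order.TTheory GRing.Theory Num.Theory.
Import numFieldNormedType.Exports.

Local Open Scope classical_set_scope.
Local Open Scope complex_scope.
Local Open Scope quotient_scope.
Local Open Scope ring_scope.

Definition smooth_curve (R : realType) (I : set R) (f : R -> R) : Prop :=
  forall (k : nat) (s : R), I s -> derivable (derive1n k f) s 1.

Definition smooth_curveC (R : realType) (I : set R) (f : R -> R[i]) : Prop :=
  smooth_curve I (fun s => complex.Re (f s)) /\
  smooth_curve I (fun s => complex.Im (f s)).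

Definition is_deriveC (R : realType) (f : R -> R[i]) (s : R) (d : R[i]) : Prop :=
  is_derive s 1 (fun t => complex.Re (f t)) (complex.Re d) /\
  is_derive s 1 (fun t => complex.Im (f t)) (complex.Im d).

Definition two_pi_Z (R : realType) : {pred R} :=
  fun x => `[< exists k : int, x = k%:~R * (2 * pi) >].

Lemma two_pi_Z_zmod_closed (R : realType) : zmod_closed (@two_pi_Z R).
Proof.
split; first by apply/asboolP; exists 0; rewrite mul0r.
move=> x y /asboolP[k ->] /asboolP[l ->]; apply/asboolP; exists (k - l).
by rewrite rmorphB mulrBl.
Qed.

HB.instance Definition _ (R : realType) :=
  GRing.isZmodClosed.Build R (@two_pi_Z R) (@two_pi_Z_zmod_closed R).

Definition circle (R : realType) := @Quotient.quot R (@two_pi_Z R).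

Definition to_circle (R : realType) (x : R) : circle R := \pi_(circle R) x.

Definition expi (R : realType) (x : R) : R[i] := cos x +i* sin x.

(* The value does not depend on the representative, cos and sin being
   2pi-periodic. *)
Definition expi_circle (R : realType) (a : circle R) : R[i] := expi (repr a).

Variant angle_fun (R : realType) : Type :=
  | RealAngle of (R -> R)
  | CircleAngle of (R -> circle R).

Definition angle_at (R : realType) (th : angle_fun R) (s : R) : circle R :=
  match th with
  | RealAngle f => to_circle (f s)
  | CircleAngle t => t s
  end.

Definition expi_at (R : realType) (th : angle_fun R) (s : R) : R[i] :=
  match th with
  | RealAngle f => expi (f s)
  | CircleAngle t => expi_circle (t s)
  end.

(* The smooth structure of R/2piZ is the one for which R -> R/2piZ is a local
   diffeomorphism: smoothness and derivatives are those of local real lifts. *)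
Definition smooth_angle (R : realType) (I : set R) (th : angle_fun R) : Prop :=
  match th with
  | RealAngle f => smooth_curve I f
  | CircleAngle t => forall s : R, I s ->
      exists (J : set R) (f : R -> R),
        [/\ open J, J s, smooth_curve J f & forall r, J r -> t r = to_circle (f r)]
  end.

Definition is_derive_angle (R : realType) (th : angle_fun R) (s d : R) : Prop :=
  match th with
  | RealAngle f => is_derive s 1 f d
  | CircleAngle t => exists f : R -> R,
      (\forall r \near s, t r = to_circle (f r)) /\ is_derive s 1 f d
  end.

Definition partial (R : realType) (p q : nat) (i : 'I_p)
    (f : 'rV[R]_p -> 'rV[R]_q) : 'rV[R]_p -> 'rV[R]_q :=
  fun x => 'D_(delta_mx 0 i) f x.

(* C^infinity on the open set U: every iterated partial derivative is (Frechet)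
   differentiable, hence continuous, at every point of U. *)
Definition smooth_on (R : realType) (p q : nat) (U : set 'rV[R]_p)
    (f : 'rV[R]_p -> 'rV[R]_q) : Prop :=
  forall (l : seq 'I_p) (x : 'rV[R]_p), U x ->
    differentiable (foldr (@partial R p q) f l) x.

(* Smoothness on an arbitrary subset A: local smooth extendability. *)
Definition smooth_map (R : realType) (p q : nat) (A : set 'rV[R]_p)
    (f : 'rV[R]_p -> 'rV[R]_q) : Prop :=
  forall x, A x -> exists (U : set 'rV[R]_p) (F : 'rV[R]_p -> 'rV[R]_q),
    [/\ open U, U x, smooth_on U F & forall y, A y -> U y -> f y = F y].

Definition diffeomorphism (R : realType) (p q : nat)
    (A : set 'rV[R]_p) (B : set 'rV[R]_q) (f : 'rV[R]_p -> 'rV[R]_q) : Prop :=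
  exists g : 'rV[R]_q -> 'rV[R]_p,
    [/\ smooth_map A f, smooth_map B g,
        (forall x, A x -> B (f x) /\ g (f x) = x) &
        (forall y, B y -> A (g y) /\ f (g y) = y)].

Definition diffeomorphic (R : realType) (p q : nat)
    (A : set 'rV[R]_p) (B : set 'rV[R]_q) : Prop :=
  exists f : 'rV[R]_p -> 'rV[R]_q, diffeomorphism A B f.

(* phi, restricted to V, parametrizes a relatively open subset of L. *)
Definition local_param (R : realType) (n q : nat) (L : set 'rV[R]_q)
    (V : set 'rV[R]_n) (phi : 'rV[R]_n -> 'rV[R]_q) : Prop :=
  open V /\
  exists U : set 'rV[R]_q, open U /\ diffeomorphism V (L `&` U) phi.

Definition embedded_submanifold (R : realType) (n q : nat) (L : set 'rV[R]_q) : Prop :=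
  forall p, L p -> exists (V : set 'rV[R]_n) (phi : 'rV[R]_n -> 'rV[R]_q),
    local_param L V phi /\ exists2 u, V u & phi u = p.

(* The rows of 'J phi u are the coordinate tangent vectors of phi at u. *)
Definition tangent (R : realType) (n q : nat) (L : set 'rV[R]_q)
    (p v : 'rV[R]_q) : Prop :=
  exists (V : set 'rV[R]_n) (phi : 'rV[R]_n -> 'rV[R]_q) (u c : 'rV[R]_n),
    [/\ local_param L V phi, V u, phi u = p & v = c *m 'J phi u].

Definition euclid (R : realType) (q : nat) (u v : 'rV[R]_q) : R :=
  \sum_i u 0 i * v 0 i.

(* N is the component of v normal to the n-dimensional submanifold L at p. *)
Definition is_normal_part (R : realType) (n q : nat) (L : set 'rV[R]_q)
    (p v N : 'rV[R]_q) : Prop :=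
  tangent n L p (v - N) /\ forall t, tangent n L p t -> euclid t N = 0.

(* The induced metric g_ij in the parametrization phi. *)
Definition metric (R : realType) (n q : nat) (phi : 'rV[R]_n -> 'rV[R]_q)
    (u : 'rV[R]_n) : 'M[R]_n :=
  'J phi u *m ('J phi u)^T.

(* H is the trace of the second fundamental form,
   H = (sum_ij g^ij d_i d_j phi)^perp, which is independent of the local
   parametrization used to compute it. *)
Definition is_mean_curvature (R : realType) (n q : nat) (L : set 'rV[R]_q)
    (p H : 'rV[R]_q) : Prop :=
  exists (V : set 'rV[R]_n) (phi : 'rV[R]_n -> 'rV[R]_q) (u : 'rV[R]_n),
    [/\ local_param L V phi, V u, phi u = p &
        is_normal_part n L p
          (\sum_i \sum_j invmx (metric phi u) i j *: partial i (partial j phi) u)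
          H].

(* Both H and the normal part of T are uniquely determined at each point. *)
Definition translating_soliton (R : realType) (n q : nat) (L : set 'rV[R]_q)
    (T : 'rV[R]_q) : Prop :=
  embedded_submanifold n L /\
  forall p, L p ->
    exists2 H, is_mean_curvature n L p H & is_normal_part n L p T H.

Definition zcoord (R : realType) (n : nat) (v : 'rV[R]_(n + n)) (j : 'I_n) : R[i] :=
  v 0 (lshift n j) +i* v 0 (rshift n j).

Definition ofC (R : realType) (n : nat) (z : 'rV[R[i]]_n) : 'rV[R]_(n + n) :=
  row_mx (\row_j complex.Re (z 0 j)) (\row_j complex.Im (z 0 j)).

Definition omega (R : realType) (n : nat) (u v : 'rV[R]_(n + n)) : R :=
  \sum_(j < n) (u 0 (lshift n j) * v 0 (rshift n j) -
                v 0 (lshift n j) * u 0 (rshift n j)).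

(* (dz_1 /\ ... /\ dz_n)(B_1, ..., B_n), B_i being the rows of B *)
Definition dz_form (R : realType) (n : nat) (B : 'M[R]_(n, n + n)) : R[i] :=
  \det (\matrix_(i < n, k < n) zcoord (row i B) k).

Definition lagrangian (R : realType) (n : nat) (L : set 'rV[R]_(n + n)) : Prop :=
  embedded_submanifold n L /\
  forall p u v, L p -> tangent n L p u -> tangent n L p v -> omega u v = 0.

(* An orientation of L, given as a family A of local parametrizations covering L.
   The matrix P relating the two coordinate frames at a common point is the
   Jacobian matrix of the change of coordinates. *)
Definition oriented_atlas (R : realType) (n q : nat) (L : set 'rV[R]_q)
    (A : set (set 'rV[R]_n * ('rV[R]_n -> 'rV[R]_q))) : Prop :=
  [/\ forall V phi, A (V, phi) -> local_param L V phi,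
      forall p, L p -> exists V phi, A (V, phi) /\ exists2 u, V u & phi u = p &
      forall V phi V' phi', A (V, phi) -> A (V', phi') ->
        forall u u', V u -> V' u' -> phi u = phi' u' ->
          exists P : 'M[R]_n, 0 < \det P /\ 'J phi u = P *m 'J phi' u'].

(* In positively oriented coordinates vol_L(d_1 phi, ..., d_n phi) is
   sqrt (det g), so this says dz_1 /\ ... /\ dz_n |_L = e^(i theta) vol_L for some
   orientation of L. Only the values of theta on L matter. *)
Definition lagrangian_angle (R : realType) (n : nat) (L : set 'rV[R]_(n + n))
    (theta : 'rV[R]_(n + n) -> circle R) : Prop :=
  exists2 A : set (set 'rV[R]_n * ('rV[R]_n -> 'rV[R]_(n + n))),
    oriented_atlas L A &
    forall V phi u, A (V, phi) -> V u ->
      dz_form ('J phi u) =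
      expi_circle (theta (phi u)) * (Num.sqrt (\det (metric phi u)))%:C.

Definition special_lagrangian (R : realType) (n : nat)
    (L : set 'rV[R]_(n + n)) : Prop :=
  lagrangian L /\ exists c : circle R, lagrangian_angle L (fun=> c).

(* The dimension is n = m + 1: m coordinates x_j w_j(s) followed by the last one. *)
Definition soliton_point (R : realType) (m : nat) (lambda : 'I_m -> R)
    (w : 'I_m -> R -> R[i]) (beta : R -> R[i]) (x : 'rV[R]_m) (s : R) :
    'rV[R]_((m + 1) + (m + 1)) :=
  ofC (row_mx (\row_(j < m) ((x 0 j)%:C * w j s))
              ((- 2^-1 * \sum_(j < m) lambda j * x 0 j ^+ 2)%:C + beta s)%:M).

Definition soliton_set (R : realType) (m : nat) (I : set R) (lambda : 'I_m -> R)
    (w : 'I_m -> R -> R[i]) (beta : R -> R[i]) : set 'rV[R]_((m + 1) + (m + 1)) :=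
  [set p | exists x s, I s /\ p = soliton_point lambda w beta x s].

(* Main.v *)
Require Import Defs.
From HB Require Import structures.
From mathcomp Require Import all_boot all_order all_algebra.
From mathcomp Require Import generic_quotient ring_quotient complex.
From mathcomp Require Import all_classical all_reals all_analysis.
From mathcomp Require Import ring lra.

Set Implicit Arguments.
Unset Strict Implicit.
Unset Printing Implicit Defensive.

Import Order.TTheory GRing.Theory Num.Theory.
Import numFieldNormedType.Exports.

Local Open Scope classical_set_scope.
Local Open Scope complex_scope.
Local Open Scope ring_scope.

(** Write [m] for the number of the curves [w_j], [P = w_1 ... w_m],
    [E = e^(i theta)], and [Phi (x, s)] for the point of [L] with parameters
    [x] in R^m and [s] in [I]. Everything rests on one consequence of the
    equations, [wdot_conj]:
        [w_j' conj w_j = lambda_j beta'],  with [beta' = E conj P].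

    Lagrangian angle. Because of this relation the hermitian product of any two
    derivatives of [Phi] is real ([herm_Phi1]), and the directions [x_j] are
    orthogonal to the direction [s]. Its imaginary part is the symplectic form, so
    [L] is Lagrangian. The complex Jacobian matrix is a diagonal matrix bordered by
    one row and one column, with determinant [E] times the positive number
    [|P|^2 rho] ([det_Phi1]); for a Lagrangian frame the volume density is the
    modulus of this determinant ([det_gram_polar]), hence [theta] is the angle.

    Embedding. The inverse of [Phi] is explicit once [s] is known, since [x_j] is
    [z_j / w_j s]. To recover [s] from the point one needs a monotone equation.
    The number [Im beta'] satisfies a linear equation that integrates to
    [Im beta' = c e^(- alpha Re beta)] ([Im_betadotE]). If [c] is nonzero,
    [Im z_n = Im beta s] is monotone in [s] ([time_function_Im]). If [c = 0], then
    [Re beta'] never vanishes, and the equation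
        [Re z_n = Re (beta s) - sum_j lambda_j |z_j|^2 / (2 |w_j s|^2)]
    is monotone in [s], because [|w_j|^2] has derivative [2 lambda_j Re beta']
    ([time_function_Re]). In both cases [s] is a smooth function on an open set
    containing [L], by an implicit function theorem for one scalar unknown
    ([separated_implicit]). As an open interval is diffeomorphic to the line
    ([interval_chartP]), [L] is diffeomorphic to R^(m+1).

    Translation. A vector is tangent to a Lagrangian if and only if its symplectic
    products with all tangent vectors vanish ([lagrangian_maximal]). Thus [H] is the
    normal part of [T] as soon as the trace of the second derivatives of [Phi] and
    [T] have the same symplectic product with every tangent vector
    ([global_translating_soliton]). These products for the second derivatives form
    a symmetric cubic form ([Im_herm_Phi2]), and the metric is block diagonal, a
    rank one perturbation of a diagonal matrix and a scalar, so its inverse and the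
    trace are explicit ([mean_curvature_Phi]): it is [- theta'] in the direction [s]
    and zero in the directions [x_j], like the product with [T]. For [alpha = 0]
    the angle is constant. *)

(** * Iterated directional differentiability *)

(** [k]-fold differentiability of [f] on [U] along the directions of [E]. The
    recursion is on [k], so that each closure property is an induction that only
    uses the formula for the first derivative; taking the directions as a
    parameter lets the same closure properties serve functions of one variable
    ([E = [set 1]]) and functions on row vectors ([E] the standard basis). *)
Fixpoint Ck (R : realType) (V W : normedModType R) (E U : set V) (k : nat)
    (f : V -> W) : Prop :=
  if k is k'.+1 then
    (forall x, U x -> differentiable f x) /\
    (forall v, E v -> Ck E U k' (fun x => 'D_v f x))
  else True.

Section CkTheory.
Variables (R : realType) (V : normedModType R) (E U : set V).
Hypothesis openU : open U.

Lemma near_open (x : V) (P : V -> Prop) :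
  U x -> (forall y, U y -> P y) -> \forall y \near x, P y.
Proof. by move=> Ux UP; apply: (filterS UP); exact: open_nbhs_nbhs. Qed.

Lemma near_differentiable (W : normedModType R) (f g : V -> W) x :
  (\near x, f x = g x) -> differentiable f x -> differentiable g x.
Proof.
move=> fg /diff_locallyP[cd df].
have fgx : f x = g x by exact: (nbhs_singleton fg).
pose d : {linear V -> W} := 'd f x.
have dg : g \o shift x = cst (g x) + d +o_ 0 id.
  apply/eqaddoE; rewrite -fgx.
  apply/eqaddoP => _/posnumP[e].
  have := df; move/eqaddoP => /(_ e%:num ltac:(by [])) df1.
  have fg0 : \forall y \near 0, f (y + x) = g (y + x).
    by have := fg; rewrite (near_shift 0) /= subr0.
  near=> y.
  have <- : (f \o shift x - (cst (f x) + 'd f x)) y =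
            (g \o shift x - (cst (f x) + d)) y.
    by rewrite /= !fctE /=; congr (_ - _); near: y.
  by near: y.
have dE : 'd g x = d :> (V -> W) by apply: diff_unique.
apply/diff_locallyP; rewrite dE; split => //.
Unshelve. all: by end_near. Qed.

Lemma Ck_ext (W : normedModType R) k (f g : V -> W) :
  (forall x, U x -> f x = g x) -> Ck E U k f -> Ck E U k g.
Proof.
elim: k f g => // k IH f g fg [df Df]; split=> [x Ux|v Ev].
  by apply: near_differentiable (df x Ux); exact: near_open.
apply: IH (Df v Ev) => x Ux.
by apply: near_eq_derive; exact: near_open.
Qed.

Lemma CkW (W : normedModType R) k (f : V -> W) : Ck E U k.+1 f -> Ck E U k f.
Proof.
elim: k f => // k IH f [df Df]; split=> // v Ev.
by apply: IH; exact: Df.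
Qed.

Lemma Ck_cst (W : normedModType R) k (a : W) : Ck E U k (fun _ : V => a).
Proof.
elim: k a => // k IH a; split=> [x _|v _]; first exact: differentiable_cst.
by apply: Ck_ext (IH 0) => x _; rewrite derive_cst.
Qed.

Lemma CkD k (f g : V -> R) :
  Ck E U k f -> Ck E U k g -> Ck E U k (fun x => f x + g x).
Proof.
elim: k f g => // k IH f g [df Df] [dg Dg]; split=> [x Ux|v Ev].
  by apply: differentiableD; [exact: df|exact: dg].
apply: Ck_ext (IH _ _ (Df v Ev) (Dg v Ev)) => x Ux.
by rewrite -deriveD //; apply: diff_derivable; [exact: df|exact: dg].
Qed.

Lemma CkM k (f g : V -> R) :
  Ck E U k f -> Ck E U k g -> Ck E U k (fun x => f x * g x).
Proof.
elim: k f g => // k IH f g /[dup] Sf [df Df] /[dup] Sg [dg Dg].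
split=> [x Ux|v Ev].
  by apply: differentiableM; [exact: df|exact: dg].
apply: Ck_ext (CkD (IH _ _ (CkW Sf) (Dg v Ev)) (IH _ _ (CkW Sg) (Df v Ev))).
move=> x Ux.
rewrite (_ : (fun y => f y * g y) = f * g) // deriveM //;
  apply: diff_derivable; [exact: df|exact: dg].
Qed.

Lemma CkMl k (a : R) (f : V -> R) :
  Ck E U k f -> Ck E U k (fun x => a * f x).
Proof. by move=> Sf; exact: CkM (Ck_cst k a) Sf. Qed.

Lemma CkN k (f : V -> R) : Ck E U k f -> Ck E U k (fun x => - f x).
Proof.
by move=> /(CkMl (-1)) Sf; apply: Ck_ext Sf => x _; rewrite mulN1r.
Qed.

Lemma CkB k (f g : V -> R) :
  Ck E U k f -> Ck E U k g -> Ck E U k (fun x => f x - g x).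
Proof. by move=> Sf /CkN Sg; exact: CkD. Qed.

Lemma Ck_sum k (I : Type) (r : seq I) (f : I -> V -> R) :
  (forall i, Ck E U k (f i)) -> Ck E U k (fun x => \sum_(i <- r) f i x).
Proof.
move=> Sf; elim: r => [|i r IH].
  by apply: Ck_ext (Ck_cst k (0 : R)) => x _; rewrite big_nil.
by apply: Ck_ext (CkD (Sf i) IH) => x _; rewrite big_cons.
Qed.

Lemma CkX k n (f : V -> R) : Ck E U k f -> Ck E U k (fun x => f x ^+ n).
Proof.
move=> Sf; elim: n => [|n IH].
  by apply: Ck_ext (Ck_cst k (1 : R)) => x _; rewrite expr0.
by apply: Ck_ext (CkM Sf IH) => x _; rewrite exprS.
Qed.

Lemma CkV k (f : V -> R) : (forall x, U x -> f x != 0) ->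
  Ck E U k f -> Ck E U k (fun x => (f x)^-1).
Proof.
move=> f0; elim: k => // k IH /[dup] Sf [df Df]; split=> [x Ux|v Ev].
  by apply: differentiableV; [exact: df|exact: f0].
have Sv := IH (CkW Sf).
apply: Ck_ext (CkN (CkM (CkX 2 Sv) (Df v Ev))) => x Ux.
rewrite deriveV ?f0 //; last by apply: diff_derivable; exact: df.
by rewrite -exprVn -mulNr.
Qed.

Lemma Ck_div k (f g : V -> R) : (forall x, U x -> g x != 0) ->
  Ck E U k f -> Ck E U k g -> Ck E U k (fun x => f x / g x).
Proof. by move=> g0 Sf /(CkV g0) Sg; exact: CkM. Qed.

Lemma Ck_row k n (f : V -> 'rV[R]_n) :
  (forall j, Ck E U k (fun x => f x 0 j)) -> Ck E U k f.
Proof.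
elim: k f => // k IH f Sf.
have fE : f = fun x => \sum_j (f x 0 j) *: delta_mx 0 j.
  by apply/funext => x; rewrite -row_sum_delta.
have df x : U x -> differentiable f x.
  move=> Ux; rewrite fE.
  rewrite (_ : (fun y => _) =
    \sum_(j < n) (fun y => f y 0 j *: (delta_mx 0 j : 'rV[R]_n))); last first.
    by apply/funext => y; rewrite fct_sumE.
  apply: differentiable_sum => j.
  by apply: differentiableZl; case: (Sf j) => /(_ x Ux).
split=> // v Ev; apply: IH => j.
have [_ /(_ v Ev) Sj] := Sf j.
apply: Ck_ext Sj => x Ux.
by rewrite derive_mx ?mxE //; apply: diff_derivable; exact: df.
Qed.

Lemma Ck_comp k (J : set R) (h : R -> R) (f : V -> R) :
  (forall x, U x -> J (f x)) ->
  Ck [set (1 : R)] J k h -> Ck E U k f -> Ck E U k (fun x => h (f x)).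
Proof.
move=> UJ; elim: k h => // k IH h [dh Dh] /[dup] Sf [df Df].
split=> [x Ux|v Ev].
  by apply: (@differentiable_comp _ _ _ _ f h); [exact: df|apply: dh; exact: UJ].
apply: Ck_ext (CkM (IH _ (Dh 1 erefl) (CkW Sf)) (Df v Ev)) => x Ux.
have dhx := dh _ (UJ x Ux).
have dfx := df _ Ux.
rewrite [RHS]deriveE; last exact: (@differentiable_comp _ _ _ _ f h).
rewrite -[RHS]/('d (h \o f) x v) diff_comp //= diff1E // derive1E -deriveE //.
exact: mulrC.
Qed.

End CkTheory.

Lemma Ck_sub (R : realType) (V W : normedModType R) (E U U' : set V) k
    (f : V -> W) : U' `<=` U -> Ck E U k f -> Ck E U' k f.
Proof.
move=> UU; elim: k f => // k IH f [df Df]; split=> [x /UU|v Ev]; first exact: df.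
by apply: IH; exact: Df.
Qed.

Lemma Ck_id (R : realType) (U : set R) k : open U -> Ck [set (1 : R)] U k (@id R).
Proof.
move=> oU; case: k => // k; split=> [x _|_ ->]; first exact: ex_diff.
by apply: (Ck_ext oU _ (Ck_cst _ oU k (1 : R))) => x _; rewrite derive_id.
Qed.

Lemma Ck_coord (R : realType) n (E U : set 'rV[R]_n) k j : open U ->
  Ck E U k (fun x : 'rV[R]_n => x 0 j).
Proof.
move=> oU; case: k => // k; split=> [x _|v _]; first exact: differentiable_coord.
apply: (Ck_ext oU _ (Ck_cst _ oU k (v 0 j))) => x _.
have := @derive_mx R _ 1 n id x v (@derivable_id _ _ x v).
by rewrite derive_id => /matrixP/(_ 0 j); rewrite !mxE.
Qed.

Lemma smooth_curve_Ck (R : realType) (I : set R) (f : R -> R) :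
  smooth_curve I f -> forall k, Ck [set (1 : R)] I k f.
Proof.
move=> sf k; rewrite -[f](derive1n0 f); move: 0%N.
elim: k => // k IH j; split=> [x Ix|_ ->].
  by apply/derivable1_diffP; exact: sf.
rewrite (_ : (fun x => _) = f^`(j.+1)%classic) //.
by apply/funext => x; rewrite derive1nS derive1E.
Qed.

Definition stdbasis (R : realType) n : set 'rV[R]_n :=
  [set v | exists i, v = delta_mx 0 i].

Lemma Ck_smooth_on (R : realType) p q (U : set 'rV[R]_p)
    (f : 'rV[R]_p -> 'rV[R]_q) :
  (forall k, Ck (@stdbasis R p) U k f) -> smooth_on U f.
Proof.
move=> sf l x Ux.
suff: forall k, Ck (@stdbasis R p) U k (foldr (@partial R p q) f l).
  by move=> /(_ 1%N)[/(_ x Ux)].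
elim: l => //= i l IH k.
by have [_ +] := IH k.+1; apply; exists i.
Qed.

(** * Functions of one variable on an interval *)

Section Interval.
Variables (R : realType) (I : set R).
Hypotheses (openI : open I) (itvI : is_interval I).

Lemma is_interval_in (a b : R) : I a -> I b -> forall t, t \in `[a, b] -> I t.
Proof. by move=> Ia Ib t; rewrite in_itv /=; exact: itvI. Qed.

Lemma interval_continuous (f : R -> R) (a b : R) :
  (forall s, I s -> derivable f s 1) -> I a -> I b ->
  {within `[a, b], continuous f}.
Proof.
move=> df Ia Ib; apply: derivable_within_continuous => t tab.
by apply: df; exact: is_interval_in tab.
Qed.

Lemma interval_derive_gt0_lt (f : R -> R) :
  (forall s, I s -> derivable f s 1) -> (forall s, I s -> 0 < 'D_1 f s) ->
  forall s t, I s -> I t -> s < t -> f s < f t.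
Proof.
move=> df f'0 s t Is It st.
have Iin u : u \in `]s, t[ -> I u.
  by rewrite in_itv /= => /andP[su ut]; apply: (itvI Is It); rewrite !ltW.
apply: (gtr0_derive1_lt_cc (a := s) (b := t)) => //.
- by move=> u /Iin; exact: df.
- by move=> u /Iin; rewrite derive1E; exact: f'0.
- exact: interval_continuous.
- by rewrite in_itv /= lexx ltW.
- by rewrite in_itv /= lexx ltW.
Qed.

Lemma interval_derive0_cst (f : R -> R) : (forall s, I s -> is_derive s 1 f 0) ->
  forall s t, I s -> I t -> f s = f t.
Proof.
move=> df.
suff H s t : I s -> I t -> s < t -> f s = f t.
  move=> s t Is It; case: (ltgtP s t) => [st|ts|->//]; first exact: H.
  by apply/esym; exact: H.
move=> Is It st.
have Iin u : u \in `]s, t[ -> I u.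
  by rewrite in_itv /= => /andP[su ut]; apply: (itvI Is It); rewrite !ltW.
have [||c _] := @MVT R f (fun=> 0) s t st.
- by move=> u /Iin; exact: df.
- by apply: interval_continuous => // u /df [].
by rewrite mul0r => /eqP; rewrite subr_eq0 => /eqP ->.
Qed.

Lemma interval_nonzero_sign (f : R -> R) :
  (forall s, I s -> derivable f s 1) -> (forall s, I s -> f s != 0) ->
  exists e : R, forall s, I s -> 0 < e * f s.
Proof.
move=> df f0; have [[s0 Is0]|nI] := pselect (I !=set0); last first.
  by exists 1 => s Is; case: nI; exists s.
exists (f s0).
suff H s t : I s -> I t -> s <= t -> 0 < f s * f t.
  move=> s Is; case: (leP s0 s) => st; first exact: H.
  by rewrite mulrC; apply: H => //; exact: ltW.
move=> Is It st; rewrite ltNge; apply/negP => fst.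
have [||c cst /eqP] := @IVT R f s t 0 st; first exact: interval_continuous.
- have fs := f0 s Is; have ft := f0 t It.
  case: (ltgtP (f s) 0) fs => // fs _; case: (ltgtP (f t) 0) ft => // ft _.
  + by move: fst; rewrite leNgt nmulr_rgt0 ?ft.
  + by rewrite ge_min le_max (ltW fs) (ltW ft) orbT.
  + by rewrite ge_min le_max (ltW fs) (ltW ft) orbT.
  + by move: fst; rewrite leNgt pmulr_rgt0 ?ft.
by apply/negP; apply: f0; exact: is_interval_in cst.
Qed.

End Interval.

(** * A scalar implicit function theorem *)

(** Caratheodory's form of the product rule: where one factor vanishes, continuity
    of the other one is enough. Combined with difference quotients, it gives the
    differentiability of implicit functions without differentiating the equation
    jointly in both variables. *)
Lemma differentiable_mul0 (R : realType) (V : normedModType R) (f g : V -> R) z :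
  differentiable f z -> f z = 0 -> {for z, continuous g} ->
  differentiable (fun x => f x * g x) z /\
  forall v, 'd (fun x => f x * g x) z v = g z * 'd f z v.
Proof.
move=> df fz0 cg.
pose d : {linear V -> R} := (g z \*: 'd f z).
have cd : continuous d.
  by move=> x; apply: cvgZr; exact: (diff_continuous df).
have [C C0 dC] := linear_lipschitz (diff_continuous df).
have dfg : (fun x => f x * g x) \o shift z = cst (f z * g z) + d +o_ 0 id.
  apply/eqaddoE/eqaddoP => _/posnumP[e]; rewrite fz0 mul0r.
  pose M := `|g z| + 1; have M0 : 0 < M by rewrite ltr_wpDl.
  have e1 : 0 < e%:num / 2 / M by rewrite !divr_gt0.
  have e2 : 0 < e%:num / 2 / C by rewrite !divr_gt0.
  have [_ dfo] := (diff_locallyP z f).1 df.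
  have := dfo; move/eqaddoP => /(_ _ e1) H1.
  have cgz : g x @[x --> z] --> g z by exact: cg.
  move/cvgrPdist_lt : cgz => cgz.
  have H2 : \forall h \near 0, `|g z - g (h + z)| < e%:num / 2 / C.
    have : \forall t \near z, `|g z - g t| < e%:num / 2 / C by exact: cgz.
    by rewrite (near_shift 0 z) /= subr0.
  have H3 : \forall h \near 0, `|g z - g (h + z)| < 1.
    have : \forall t \near z, `|g z - g t| < 1 by exact: cgz ltr01.
    by rewrite (near_shift 0 z) /= subr0.
  near=> h.
  (* Freeze [g] at [z]: the first error is that of [f], the second one is the
     oscillation of [g] times the Lipschitz bound of the differential. *)
  have -> : ((fun x => f x * g x) \o shift z - (cst 0 + d)) h =
      g (h + z) * ((f \o shift z - (cst (f z) + 'd f z)) h)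
      + (g (h + z) - g z) * 'd f z h.
    rewrite /d /= !fctE /= /cst fz0 /=.
    set dfh : R := 'd f z h; rewrite -[g z *: _]/(g z * dfh).
    by rewrite !add0r; ring.
  have K1 : `|g (h + z)| <= M.
    rewrite -[g (h + z)](subrK (g z)) addrC (le_trans (ler_normD _ _)) //.
    by rewrite lerD2l ltW // distrC; near: h.
  have K2 : `|((f \o shift z - (cst (f z) + 'd f z)) h)|
      <= e%:num / 2 / M * `|h| by near: h.
  have K3 : `|g (h + z) - g z| <= e%:num / 2 / C.
    by rewrite distrC ltW //; near: h.
  rewrite (le_trans (ler_normD _ _)) // !normrM.
  rewrite [e%:num]splitr mulrDl lerD //.
    have -> : e%:num / 2 * `|h| = M * (e%:num / 2 / M * `|h|).
      by field; rewrite gt_eqF.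
    by rewrite ler_pM.
  have -> : e%:num / 2 * `|h| = e%:num / 2 / C * (C * `|h|).
    by field; rewrite gt_eqF.
  by rewrite ler_pM.
have dE : 'd (fun x => f x * g x) z = d :> (V -> R) by apply: diff_unique.
split; last by move=> v; rewrite dE.
by apply/diff_locallyP; rewrite dE.
Unshelve. all: by end_near. Qed.

Lemma is_derive_bigsum (R : realType) (V : normedModType R) (x v : V)
    (I : Type) (r : seq I) (f : I -> V -> R) (df : I -> R) :
  (forall i, is_derive x v (f i) (df i)) ->
  is_derive x v (fun y => \sum_(i <- r) f i y) (\sum_(i <- r) df i).
Proof.
move=> dfi; elim: r => [|i r IH].
  rewrite big_nil (_ : (fun y => _) = cst 0); first exact: is_derive_cst.
  by apply/funext => y; rewrite big_nil.
rewrite big_cons (_ : (fun y => _) = f i + fun y => \sum_(i <- r) f i y).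
  exact: is_deriveD.
by apply/funext => y; rewrite big_cons.
Qed.

Lemma differentiable_bigsum (R : realType) (V : normedModType R) (x : V)
    (I : Type) (r : seq I) (f : I -> V -> R) :
  (forall i, differentiable (f i) x) ->
  differentiable (fun y => \sum_(i <- r) f i y) x.
Proof.
move=> dfi; elim: r => [|i r IH].
  rewrite (_ : (fun y => _) = cst 0); first exact: differentiable_cst.
  by apply/funext => y; rewrite big_nil.
rewrite (_ : (fun y => _) = f i + fun y => \sum_(i <- r) f i y).
  exact: differentiableD.
by apply/funext => y; rewrite big_cons.
Qed.

Lemma is_deriveMr (R : realType) (V : normedModType R) (x v : V)
    (f : V -> R) (df a : R) :
  is_derive x v f df -> is_derive x v (fun y => f y * a) (df * a).
Proof.
move=> dfx; have := is_deriveM dfx (is_derive_cst a x v).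
by rewrite scaler0 add0r => /is_derive_eq; apply; exact: mulrC.
Qed.

(** Difference quotient, completed by the derivative so as to be continuous. *)
Definition slope (R : realType) (f : R -> R) (s0 s : R) : R :=
  if s == s0 then 'D_1 f s0 else (f s - f s0) / (s - s0).

Lemma slopeM (R : realType) (f : R -> R) (s0 s : R) :
  slope f s0 s * (s - s0) = f s - f s0.
Proof.
rewrite /slope; case: eqVneq => [->|ss0]; first by rewrite !subrr mulr0.
by rewrite divfK // subr_eq0.
Qed.

Lemma slope_continuous (R : realType) (f : R -> R) (s0 : R) :
  derivable f s0 1 -> {for s0, continuous (slope f s0)}.
Proof.
move=> dfs; apply/cvgrPdist_le => e e0.
have df : differentiable f s0 by exact/derivable1_diffP.
have [_ /eqaddoP/(_ e e0) Ho] := (diff_locallyP s0 f).1 df.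
have : \forall s \near s0, `|f s - f s0 - (s - s0) * 'D_1 f s0| <= e * `|s - s0|.
  rewrite (near_shift 0 s0) /= subr0; apply: filterS Ho => h.
  rewrite !fctE /= deriv1E // derive1E addrK /cst opprD addrA.
  exact.
apply: filterS => s.
rewrite /slope eqxx; case: eqVneq => [_ _|ss0]; first by rewrite subrr normr0 ltW.
have ds0 : s - s0 != 0 by rewrite subr_eq0.
move=> H; rewrite -(ler_pM2r (_ : 0 < `|s - s0|)) ?normr_gt0 //.
by rewrite -normrM mulrBl divfK // distrC [_ * (s - s0)]mulrC.
Qed.

Section Implicit.
Variables (R : realType) (V : normedModType R) (E : set V) (T : finType).
Variables (I : set R) (B : T -> R -> R) (C : T -> V -> R).
Hypotheses (openI : open I) (itvI : is_interval I).
Hypothesis smoothB : forall l k, Ck [set (1 : R)] I k (B l).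
Hypothesis smoothC : forall l k, Ck E setT k (C l).
Hypothesis dF_gt0 : forall z s, I s -> 0 < \sum_l 'D_1 (B l) s * C l z.

Let F z s := \sum_l B l s * C l z.
Let G z s := \sum_l 'D_1 (B l) s * C l z.

Let derivB l s : I s -> derivable (B l) s 1.
Proof. by move=> Is; apply/derivable1_diffP; case: (smoothB l 1) => /(_ s Is). Qed.

Let diffC l z : differentiable (C l) z.
Proof. by case: (smoothC l 1) => /(_ z Logic.I). Qed.

Let derivF z s : I s -> is_derive s 1 (F z) (G z s).
Proof.
move=> Is; apply: is_derive_bigsum => l; apply: is_deriveMr.
by apply: derivableP; exact: derivB.
Qed.

Let diffF z s : differentiable (F^~ s) z.
Proof.
apply: differentiable_bigsum => l.
by apply: differentiableM => //; exact: differentiable_cst.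
Qed.

Let incrF z s t : I s -> I t -> s < t -> F z s < F z t.
Proof.
apply: (interval_derive_gt0_lt itvI) => u Iu; first by case: (derivF z Iu).
by have [_ ->] := derivF z Iu; exact: dF_gt0.
Qed.

Let W := [set z | exists2 s, I s & F z s = 0].
Let sol z := xget 0 [set s | I s /\ F z s = 0].

Let solP z : W z -> I (sol z) /\ F z (sol z) = 0.
Proof.
by move=> [s Is Fs]; apply: (@xgetPex _ 0 [set s | I s /\ F z s = 0]); exists s.
Qed.

Let sol_uniq z s : I s -> F z s = 0 -> sol z = s.
Proof.
move=> Is Fs; have [Iz Fz] : I (sol z) /\ F z (sol z) = 0 by apply: solP; exists s.
by case: (ltgtP (sol z) s) => // ss;
  [have := incrF z Iz Is ss|have := incrF z Is Iz ss]; rewrite Fz Fs ltxx.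
Qed.

(** Since [F z] is increasing, a sign change of [F z0] around [sol z0] persists
    for [z] near [z0] and traps a zero of [F z]. *)
Let sol_near z0 : W z0 -> forall e, 0 < e ->
  \forall z \near z0, W z /\ `|sol z0 - sol z| <= e.
Proof.
move=> /solP[I0 F0] e e0; set s0 := sol z0.
have /nbhs_ballP[r /= r0 rI] : nbhs s0 I by exact: open_nbhs_nbhs.
have {r r0 rI} [d [d0 de Im Ip]] :
    exists d, [/\ 0 < d, d <= e, I (s0 - d) & I (s0 + d)].
  have d0 : 0 < Num.min e (r / 2) by rewrite lt_min e0 divr_gt0.
  have dr : Num.min e (r / 2) < r.
    by rewrite gt_min [r / 2 < r]ltr_pdivrMr // ltr_pMr // ltr1n orbT.
  exists (Num.min e (r / 2)); split=> //; first by rewrite ge_min lexx.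
    by apply: rI; rewrite /ball /= opprB addrC subrK gtr0_norm.
  by apply: rI; rewrite /ball /= opprD addNKr normrN gtr0_norm.
have cF s : {for z0, continuous (F^~ s)} by exact: differentiable_continuous.
have Hm : \forall z \near z0, F z (s0 - d) < 0.
  apply: (cvgr_lt (F z0 (s0 - d))); first exact: cF.
  by rewrite -F0; apply: incrF => //; rewrite gtrBl.
have Hp : \forall z \near z0, 0 < F z (s0 + d).
  apply: (cvgr_gt (F z0 (s0 + d))); first exact: cF.
  by rewrite -F0; apply: incrF => //; rewrite ltrDl.
near=> z.
have Fm : F z (s0 - d) < 0 by near: z.
have Fp : 0 < F z (s0 + d) by near: z.
have dd : s0 - d <= s0 + d by lra.
have [||s sd Fs] := @IVT R (F z) (s0 - d) (s0 + d) 0 dd.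
- by apply: (interval_continuous itvI) => // u /(derivF z) [].
- by rewrite ge_min le_max (ltW Fm) (ltW Fp) orbT.
have Is : I s by apply: (is_interval_in itvI) sd.
split; first by exists s.
rewrite (sol_uniq Is Fs); move: sd; rewrite in_itv /= => /andP[s1 s2].
by rewrite ler_norml; apply/andP; split; rewrite -/s0; lra.
Unshelve. all: by end_near. Qed.

Let openW : open W.
Proof.
rewrite openE => z Wz; have := sol_near Wz ltr01.
by rewrite /interior; apply: filterS => ? [].
Qed.

Let sol_continuous z : W z -> {for z, continuous sol}.
Proof.
move=> Wz; apply/cvgrPdist_le => e e0.
by have := sol_near Wz e0; apply: filterS => ? [].
Qed.

(** [F z s - F z s0] is [s - s0] times a combination of slopes, so that near a
    solution [sol z' - s0] is the quotient of [- F z' s0], which vanishes at [z], by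
    a continuous function. *)
Let sol_diff z : W z -> differentiable sol z /\
  forall v, 'D_v sol z = - (\sum_l B l (sol z) * 'D_v (C l) z) / G z (sol z).
Proof.
move=> Wz; have [Iz Fz] := solP Wz; set s0 := sol z in Iz Fz *.
pose K z' := \sum_l slope (B l) s0 (sol z') * C l z'.
have Kz : K z = G z s0 by apply: eq_bigr => l _; rewrite /slope eqxx.
have K0 : K z != 0 by rewrite Kz gt_eqF // dF_gt0.
have cK : {for z, continuous K}.
  rewrite /continuous_at /K; apply: cvg_big => [|l _].
    exact: add_continuous.
  apply: cvgM.
    apply: continuous_comp; first exact: sol_continuous.
    by apply: slope_continuous; exact: derivB.
  exact: differentiable_continuous.
have FK z' : W z' -> - F z' s0 = (sol z' - s0) * K z'.
  move=> /solP[_ Fz']; rewrite -[LHS]add0r -Fz' /F /K -sumrB mulr_sumr.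
  by apply: eq_bigr => l _; rewrite mulrA [_ * slope _ _ _]mulrC slopeM mulrBl.
have dN : differentiable (fun z' => - F z' s0) z by apply: differentiableN.
have [||df dfE] := @differentiable_mul0 R V (fun z' => - F z' s0)
  (fun z' => (K z')^-1) z dN; [by rewrite Fz oppr0|exact: cvgV|].
have solE : \forall z' \near z, s0 + - F z' s0 * (K z')^-1 = sol z'.
  have K0' : \forall z' \near z, K z' != 0.
    exact: (cvgr_neq0 (K z)).
  near=> z'; rewrite FK; last by near: z'; exact: open_nbhs_nbhs.
  have Kz' : K z' != 0 by near: z'.
  by rewrite mulfK // addrC subrK.
have ds : differentiable (cst s0 + fun z' => - F z' s0 * (K z')^-1) z.
  by apply: differentiableD => //; exact: differentiable_cst.
split=> [|v]; first exact: near_differentiable ds.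
rewrite -(near_eq_derive v solE) deriveE // diffD //.
rewrite diff_cst /= add0r dfE Kz mulrC -deriveE // deriveN; last first.
  exact: diff_derivable.
congr (- _ / _); apply: derive_val.
apply: is_derive_bigsum => l; under eq_fun do rewrite mulrC.
rewrite mulrC; apply: is_deriveMr; apply: derivableP; exact: diff_derivable.
Unshelve. all: by end_near. Qed.

(** The implicit function theorem for one scalar unknown [s], for an equation
    [\sum_l B l s * C l z = 0] that is increasing in [s]: the sum lets [z] vary
    in [V] while the dependence on [s] only involves functions of one variable,
    whose composites are covered by the closure properties above. *)
Lemma separated_implicit : exists (W : set V) (sol : V -> R),
  [/\ open W, forall k, Ck E W k sol, forall z, W z -> I (sol z) &
      forall z s, I s -> \sum_l B l s * C l z = 0 -> W z /\ sol z = s].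
Proof.
exists W, sol; split=> // [k|z /solP[]//|z s Is Fs]; last first.
  by split; [exists s|exact: sol_uniq].
elim: k => // k IH; split=> [z /sol_diff[]//|v Ev].
have S1 : Ck E W k (fun z => \sum_l B l (sol z) * 'D_v (C l) z).
  apply: Ck_sum => // l; apply: CkM => //.
    by apply: (Ck_comp openW _ (smoothB l k)) => // z /solP[].
  by apply: (Ck_sub (@subsetT _ W)); have [_] := smoothC l k.+1; apply.
have S2 : Ck E W k (fun z => G z (sol z)).
  apply: Ck_sum => // l; apply: CkM => //; last first.
    exact: (Ck_sub (@subsetT _ W)).
  apply: (Ck_comp openW (J := I) (h := fun s => 'D_1 (B l) s)) => //.
    by move=> z /solP[].
  by have [_] := smoothB l k.+1; apply.
have G0 z : W z -> G z (sol z) != 0 by move=> /solP[Iz _]; rewrite gt_eqF ?dF_gt0.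
apply: (Ck_ext openW _ (Ck_div openW G0 (CkN openW S1) S2)) => z Wz.
by have [_ ->] := sol_diff Wz.
Qed.

End Implicit.

(** * Local parametrizations and tangent vectors *)

Lemma smooth_map_differentiable (R : realType) p q (V : set 'rV[R]_p)
    (f : 'rV[R]_p -> 'rV[R]_q) u :
  open V -> smooth_map V f -> V u -> differentiable f u.
Proof.
move=> oV sf Vu; have [U [F [oU Uu sF fF]]] := sf u Vu.
have := sF [::] u Uu => /=; apply: near_differentiable.
have : nbhs u (V `&` U) by apply: open_nbhs_nbhs; split=> //; exact: openI.
by apply: filterS => y [Vy Uy]; rewrite fF.
Qed.

Section Tangent.
Variables (R : realType) (n q : nat) (L : set 'rV[R]_q).
Variables (V : set 'rV[R]_n) (Phi : 'rV[R]_n -> 'rV[R]_q).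

(** The tangent space may be computed in any single parametrization: another one
    factors near the point through [Phi], by composing it with a smooth extension
    of the inverse of [Phi], and the chain rule applies. *)
Lemma tangentE u v : local_param L V Phi -> V u ->
  tangent n L (Phi u) v <-> exists c, v = c *m 'J Phi u.
Proof.
move=> LP Vu; split=> [|[c ->]]; last by exists V, Phi, u, c.
move=> [V' [phi [u' [c [[oV' [U' [oU' [g' [sphi _ phiU' _]]]]] V'u'
  phiu' vE]]]]]; rewrite vE {vE v}.
have [oV [U [oU [g [sPhi sg gPhi Phig]]]]] := LP.
have [[Lp Up] gp] := gPhi u Vu.
have [U1 [G [oU1 U1p sG gG]]] := sg (Phi u) (conj Lp Up).
have dphi := smooth_map_differentiable oV' sphi V'u'.
have dPhi := smooth_map_differentiable oV sPhi Vu.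
have Gp : G (Phi u) = u by rewrite -gG.
have dG : differentiable G (phi u') by rewrite phiu'; exact: (sG [::]).
have phiE : \forall y \near u', (Phi \o (G \o phi)) y = phi y.
  have c1 : \forall y \near u', (U `&` U1) (phi y).
    apply: (differentiable_continuous dphi).
    by rewrite phiu'; apply: open_nbhs_nbhs; split=> //; exact: openI.
  have c2 : \forall y \near u', V' y by exact: open_nbhs_nbhs.
  near=> y.
  have [Uy U1y] : (U `&` U1) (phi y) by near: y.
  have V'y : V' y by near: y.
  have [[Ly _] _] := phiU' y V'y.
  by rewrite /= -gG //; have [_ ->] := Phig (phi y) (conj Ly Uy).
exists ('d (G \o phi) u' c).
rewrite -(deriveEjacobian c dphi) -(near_eq_derive c phiE).
have dGphi : differentiable (G \o phi) u' by exact: differentiable_comp.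
have dPhi' : differentiable Phi ((G \o phi) u') by rewrite /= phiu' Gp.
rewrite deriveE; last exact: differentiable_comp.
by rewrite diff_comp //= -deriveE // phiu' Gp deriveEjacobian.
Unshelve. all: by end_near. Qed.

Lemma diffeomorphism_local_param :
  open V -> diffeomorphism V L Phi -> local_param L V Phi.
Proof.
by move=> oV dPhi; split=> //; exists setT; rewrite setIT; split => //; exact: openT.
Qed.

Lemma diffeomorphism_embedded :
  open V -> diffeomorphism V L Phi -> embedded_submanifold n L.
Proof.
move=> oV dPhi p Lp; exists V, Phi.
split; first exact: diffeomorphism_local_param.
by have [g [_ _ _ /(_ p Lp)[Vg gp]]] := dPhi; exists (g p).
Qed.

End Tangent.

(** * Open intervals are diffeomorphic to the line *)

Lemma Ck_expR (R : realType) (U : set R) k :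
  open U -> Ck [set (1 : R)] U k (@expR R).
Proof.
move=> oU; elim: k => // k IH; split=> [x _|_ ->].
  exact/derivable1_diffP/derivable_expR.
by apply: (Ck_ext oU _ IH) => x _; rewrite derive_val.
Qed.

Lemma Ck_ln (R : realType) k : Ck [set (1 : R)] [set x : R | 0 < x] k (@ln R).
Proof.
have oU : open [set x : R | 0 < x] by exact: open_gt.
case: k => // k; split=> [x /= x0|_ ->].
  by apply/derivable1_diffP; case: (is_derive1_ln x0).
apply: (Ck_ext oU _ (CkV oU _ (Ck_id k oU))) => [x /= x0|x /= x0].
  by have [_ ->] := is_derive1_ln x0.
by rewrite gt_eqF.
Qed.

Definition interval_chart (R : realType) (I : set R) (eta kappa : R -> R) :=
  [/\ forall k, Ck [set (1 : R)] I k eta,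
      forall k, Ck [set (1 : R)] setT k kappa,
      forall t, I (kappa t) /\ eta (kappa t) = t &
      forall s, I s -> kappa (eta s) = s].

(** Each end of the interval is sent to infinity by a logarithm of the distance
    to it. *)
Lemma interval_chartP (R : realType) (I : set R) :
  open I -> is_interval I -> I !=set0 ->
  exists eta kappa, interval_chart I eta kappa.
Proof.
move=> oI iI I0.
(* An open interval is described by its bounds through its interior. *)
have IE : I = I° by apply/esym/interior_id.
have lnC (U : set R) (f : R -> R) k : open U -> (forall x, U x -> 0 < f x) ->
    Ck [set (1 : R)] U k f -> Ck [set (1 : R)] U k (fun x => ln (f x)).
  by move=> oU fU Sf; exact: (Ck_comp oU fU (Ck_ln R k) Sf).
have expC (f : R -> R) k : Ck [set (1 : R)] setT k f ->
    Ck [set (1 : R)] setT k (fun x => expR (f x)).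
  by move=> Sf; apply: (Ck_comp openT _ (Ck_expR k openT) Sf).
have idT k : Ck [set (1 : R)] setT k (@id R) by exact: Ck_id openT.
have idI k : Ck [set (1 : R)] I k (@id R) by exact: Ck_id oI.
have cT k (a : R) : Ck [set (1 : R)] setT k (fun=> a) by exact: (Ck_cst _ openT k a).
have cI k (a : R) : Ck [set (1 : R)] I k (fun=> a) by exact: (Ck_cst _ oI k a).
have [lI|lI] := pselect (has_lbound I); have [uI|uI] := pselect (has_ubound I).
- have Ilu s : I s <-> inf I < s < sup I.
    by rewrite {1}IE interval_bounded_interior.
  set a := inf I in Ilu; set b := sup I in Ilu.
  have ab : a < b.
    by have [s /Ilu/andP[s1 s2]] := I0; exact: lt_trans s1 s2.
  exists (fun s => ln (s - a) - ln (b - s)).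
  exists (fun t => (a + b * expR t) / (1 + expR t)).
  have e0 (t : R) : 0 < 1 + expR t by rewrite addr_gt0 ?expR_gt0.
  split=> [k|k|t|s /Ilu/andP[sa sb]].
  + apply: CkB => //; apply: lnC => //.
    * by move=> s /Ilu/andP[sa sb]; rewrite subr_gt0.
    * exact: CkB.
    * by move=> s /Ilu/andP[sa sb]; rewrite subr_gt0.
    * exact: CkB.
  + apply: Ck_div; first exact: openT.
    * by move=> t _; rewrite gt_eqF.
    * by apply: CkD => //; [exact: openT|apply: CkMl => //; [exact: openT|exact: expC]].
    * by apply: CkD => //; [exact: openT|exact: expC].
  + have K1 : (a + b * expR t) / (1 + expR t) - a = expR t * ((b - a) / (1 + expR t)).
      by field; rewrite gt_eqF.
    have K2 : b - (a + b * expR t) / (1 + expR t) = (b - a) / (1 + expR t).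
      by field; rewrite gt_eqF.
    have ba : 0 < (b - a) / (1 + expR t) by rewrite divr_gt0 // subr_gt0.
    split; last by rewrite K1 K2 lnM ?posrE ?expR_gt0 // expRK addrK.
    apply/Ilu; rewrite -subr_gt0 K1 -[_ < b]subr_gt0 K2 ba andbT.
    by rewrite mulr_gt0 // expR_gt0.
  + rewrite expRB !lnK ?posrE ?subr_gt0 //.
    have : b - s != 0 by rewrite gt_eqF // subr_gt0.
    have : b - a != 0 by rewrite gt_eqF // subr_gt0.
    move=> h1 h2; field; rewrite h2 /=.
    by rewrite (_ : b - s + (s - a) = b - a) //; ring.
- have Ia s : I s <-> inf I < s.
    by rewrite {1}IE interval_right_unbounded_interior.
  set a := inf I in Ia.
  exists (fun s => ln (s - a)), (fun t => a + expR t).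
  split=> [k|k|t|s /Ia sa].
  + apply: lnC => //; last exact: CkB.
    by move=> s /Ia; rewrite subr_gt0.
  + by apply: CkD => //; [exact: openT|exact: expC].
  + by rewrite [a + _]addrC addrK expRK; split=> //; apply/Ia; rewrite ltrDr expR_gt0.
  + by rewrite lnK ?posrE ?subr_gt0 // addrC subrK.
- have Ib s : I s <-> s < sup I.
    by rewrite {1}IE interval_left_unbounded_interior.
  set b := sup I in Ib.
  exists (fun s => - ln (b - s)), (fun t => b - expR (- t)).
  split=> [k|k|t|s /Ib sb].
  + apply: CkN => //; apply: lnC => //; last exact: CkB.
    by move=> s /Ib; rewrite subr_gt0.
  + by apply: CkB => //; [exact: openT|apply: expC; apply: CkN => //; exact: openT].
  + by rewrite subKr expRK opprK; split=> //; apply/Ib; rewrite gtrBl expR_gt0.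
  + by rewrite opprK lnK ?posrE ?subr_gt0 // subKr.
- have -> : I = setT by exact: interval_unbounded_setT.
  by exists id, id; split=> // t.
Qed.

(** * Calculus of complex-valued functions of real variables *)

Section ComplexDerivative.
Variables (R : realType).
Implicit Types (V : normedModType R).

(** Directional derivative of a complex-valued function, the complex plane being
    only regarded as the real plane of its real and imaginary parts. *)
Definition is_derivC V (f : V -> R[i]) (x v : V) (d : R[i]) : Prop :=
  is_derive x v (fun y => complex.Re (f y)) (complex.Re d) /\
  is_derive x v (fun y => complex.Im (f y)) (complex.Im d).

Lemma cReM (a b : R[i]) : complex.Re (a * b) =
  complex.Re a * complex.Re b - complex.Im a * complex.Im b.
Proof. by case: a b => [? ?] [? ?]. Qed.

Lemma cImM (a b : R[i]) : complex.Im (a * b) =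
  complex.Re a * complex.Im b + complex.Im a * complex.Re b.
Proof. by case: a b => [? ?] [? ?]. Qed.

Lemma cReD (a b : R[i]) : complex.Re (a + b) = complex.Re a + complex.Re b.
Proof. by case: a b => [? ?] [? ?]. Qed.

Lemma cImD (a b : R[i]) : complex.Im (a + b) = complex.Im a + complex.Im b.
Proof. by case: a b => [? ?] [? ?]. Qed.

Lemma cReN (a : R[i]) : complex.Re (- a) = - complex.Re a.
Proof. by case: a. Qed.

Lemma cImN (a : R[i]) : complex.Im (- a) = - complex.Im a.
Proof. by case: a. Qed.

Lemma cReJ (a : R[i]) : complex.Re (conjc a) = complex.Re a.
Proof. by case: a. Qed.

Lemma cImJ (a : R[i]) : complex.Im (conjc a) = - complex.Im a.
Proof. by case: a. Qed.

Lemma cReMJ (a b : R[i]) : complex.Re (a * conjc b) =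
  complex.Re a * complex.Re b + complex.Im a * complex.Im b.
Proof. by rewrite cReM cReJ cImJ mulrN opprK. Qed.

Lemma cReMr (x : R) (a : R[i]) : complex.Re (x%:C * a) = x * complex.Re a.
Proof. by rewrite cReM /= mul0r subr0. Qed.

Lemma cImMr (x : R) (a : R[i]) : complex.Im (x%:C * a) = x * complex.Im a.
Proof. by rewrite cImM /= mul0r addr0. Qed.

Lemma conjcD (x y : R[i]) : conjc (x + y) = conjc x + conjc y.
Proof. exact: rmorphD. Qed.

Lemma conjcM (x y : R[i]) : conjc (x * y) = conjc x * conjc y.
Proof. exact: rmorphM. Qed.

Lemma realCM (x y : R) : (x * y)%:C = x%:C * y%:C.
Proof. exact: rmorphM. Qed.

Lemma realCD (x y : R) : (x + y)%:C = x%:C + y%:C.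
Proof. exact: rmorphD. Qed.

Lemma realCV (x : R) : (x^-1)%:C = (x%:C)^-1.
Proof. exact: fmorphV. Qed.

Lemma realCN (x : R) : (- x)%:C = - x%:C.
Proof. exact: rmorphN. Qed.

Lemma complexP (a b : R[i]) :
  complex.Re a = complex.Re b -> complex.Im a = complex.Im b -> a = b.
Proof. by case: a b => [? ?] [? ?] /= -> ->. Qed.

Lemma cRe_sum (I : Type) (r : seq I) (P : pred I) (f : I -> R[i]) :
  complex.Re (\sum_(i <- r | P i) f i) = \sum_(i <- r | P i) complex.Re (f i).
Proof. exact: (big_morph _ cReD). Qed.

Lemma cIm_sum (I : Type) (r : seq I) (P : pred I) (f : I -> R[i]) :
  complex.Im (\sum_(i <- r | P i) f i) = \sum_(i <- r | P i) complex.Im (f i).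
Proof. exact: (big_morph _ cImD). Qed.

Lemma is_derivC_eq V (f : V -> R[i]) x v d d' :
  is_derivC f x v d -> d = d' -> is_derivC f x v d'.
Proof. by move=> H <-. Qed.

Lemma is_derivC_unique V (f : V -> R[i]) x v d d' :
  is_derivC f x v d -> is_derivC f x v d' -> d = d'.
Proof.
move=> [[_ a1] [_ a2]] [[_ b1] [_ b2]].
by apply: complexP; [rewrite -a1|rewrite -a2].
Qed.

Lemma near_eq_is_derivC V (f g : V -> R[i]) x v d :
  (\near x, f x = g x) -> is_derivC f x v d -> is_derivC g x v d.
Proof.
move=> fg [d1 d2]; split; [apply: near_eq_is_derive d1|apply: near_eq_is_derive d2].
  by apply: filterS fg => y ->.
by apply: filterS fg => y ->.
Qed.

Lemma is_derivC_cst V (a : R[i]) (x v : V) : is_derivC (fun=> a) x v 0.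
Proof. by split; exact: is_derive_cst. Qed.

Lemma is_derivC_real V (f : V -> R) x v d :
  is_derive x v f d -> is_derivC (fun y => (f y)%:C) x v d%:C.
Proof. by move=> df; split=> //; exact: is_derive_cst. Qed.

Lemma is_derivCD V (f g : V -> R[i]) x v df dg :
  is_derivC f x v df -> is_derivC g x v dg ->
  is_derivC (fun y => f y + g y) x v (df + dg).
Proof.
move=> [f1 f2] [g1 g2]; split; rewrite ?cReD ?cImD.
  under eq_fun do rewrite cReD; exact: is_deriveD.
under eq_fun do rewrite cImD; exact: is_deriveD.
Qed.

Lemma is_derivCJ V (f : V -> R[i]) x v df :
  is_derivC f x v df -> is_derivC (fun y => conjc (f y)) x v (conjc df).
Proof.
move=> [f1 f2]; split; rewrite ?cReJ ?cImJ.
  by under eq_fun do rewrite cReJ.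
under eq_fun do rewrite cImJ; exact: is_deriveN.
Qed.

Lemma is_derive_leibniz V (f g : V -> R) (x v : V) (df dg : R) :
  is_derive x v f df -> is_derive x v g dg ->
  is_derive x v (fun y => f y * g y) (df * g x + f x * dg).
Proof.
move=> f1 g1; have := is_deriveM f1 g1.
by move/is_derive_eq; apply; rewrite addrC; congr (_ + _); exact: mulrC.
Qed.

Lemma is_derivCM V (f g : V -> R[i]) x v df dg :
  is_derivC f x v df -> is_derivC g x v dg ->
  is_derivC (fun y => f y * g y) x v (df * g x + f x * dg).
Proof.
move=> [f1 f2] [g1 g2]; split.
  under eq_fun do rewrite cReM.
  have := is_deriveB (is_derive_leibniz f1 g1) (is_derive_leibniz f2 g2).
  by move/is_derive_eq; apply; rewrite cReD !cReM; ring.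
under eq_fun do rewrite cImM.
have := is_deriveD (is_derive_leibniz f1 g2) (is_derive_leibniz f2 g1).
by move/is_derive_eq; apply; rewrite cImD !cImM; ring.
Qed.

(** The product rule in logarithmic form, the one that matches the equations, in
    which [w_j'] is a multiple of the product over [w_j]. *)
Lemma is_derivC_logprod (I : eqType) (r : seq I) (f : I -> R -> R[i]) s
    (df : I -> R[i]) :
  (forall i, f i s != 0) -> (forall i, is_derivC (f i) s 1 (df i)) ->
  is_derivC (fun y => \prod_(i <- r) f i y) s 1
    (\prod_(i <- r) f i s * \sum_(i <- r) (df i / f i s)).
Proof.
move=> f0 dfi; elim: r => [|i r IH].
  rewrite !big_nil mulr0; under eq_fun do rewrite big_nil.
  exact: is_derivC_cst.
rewrite !big_cons; under eq_fun do rewrite big_cons.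
apply: is_derivC_eq (is_derivCM (dfi i) IH) _.
by have := f0 i; move=> fi0; field.
Qed.

Lemma is_derive_comp1 V (f : R -> R) (h : V -> R) x v d a :
  is_derive (h x) 1 f d -> differentiable h x -> 'D_v h x = a ->
  is_derive x v (fun y => f (h y)) (a * d).
Proof.
move=> [/derivable1_diffP df fd] dh ha.
have dfh : differentiable (f \o h) x by exact: differentiable_comp.
apply: DeriveDef; first exact: diff_derivable dfh.
rewrite -[fun y => _]/(f \o h) deriveE // diff_comp //= diff1E // -deriveE // ha.
by rewrite derive1E fd.
Qed.

Lemma is_derivC_comp V (f : R -> R[i]) (h : V -> R) x v d a :
  is_derivC f (h x) 1 d -> differentiable h x -> 'D_v h x = a ->
  is_derivC (fun y => f (h y)) x v (a%:C * d).
Proof.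
move=> [f1 f2] dh ha; split.
  rewrite cReM /= mul0r subr0; exact: is_derive_comp1.
rewrite cImM /= mul0r addr0; exact: is_derive_comp1.
Qed.

End ComplexDerivative.

(** * Angles *)

Section Angles.
Variable (R : realType).

Lemma expi_add2piz (x : R) (k : int) : expi (x + k%:~R * (2 * pi)) = expi x.
Proof.
have H (n : nat) (y : R) : expi (y + n%:R * (2 * pi)) = expi y.
  elim: n y => [|n IH] y; first by rewrite mul0r addr0.
  rewrite -natr1 mulrDl mul1r addrA -[RHS](IH y).
  by rewrite [2 * pi]mulr_natl /expi cosD2pi sinD2pi.
case: k => n; first exact: H.
by rewrite NegzE mulrNz mulNr -[in RHS](subrK (n.+1%:R * (2 * pi)) x) H.
Qed.

Lemma expi_to_circle (x : R) : expi_circle (to_circle x) = expi x.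
Proof.
have : two_pi_Z (repr (to_circle x) - x).
  have := @Quotient.idealrBE R (@two_pi_Z R) (repr (to_circle x)) x.
  by rewrite reprK eqxx.
move=> /asboolP[k xk].
by rewrite /expi_circle -[repr _](subrK x) xk addrC expi_add2piz.
Qed.

Lemma expi_circle_at (th : angle_fun R) s :
  expi_circle (angle_at th s) = expi_at th s.
Proof. by case: th => //= f; exact: expi_to_circle. Qed.

Lemma expi_norm (x : R) : expi x * conjc (expi x) = 1.
Proof.
by apply: complexP; rewrite ?cReM ?cImM /= ?mulrN ?opprK -?expr2 ?cos2Dsin2 //; ring.
Qed.

Lemma expi_at_norm (th : angle_fun R) s :
  expi_at th s * conjc (expi_at th s) = 1.
Proof. by case: th => f; exact: expi_norm. Qed.

Lemma expi_deriv (f : R -> R) (s d : R) : is_derive s 1 f d ->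
  is_derivC (fun t => expi (f t)) s (1 : R) (d *i * expi (f s)).
Proof.
move=> fd; have df : differentiable f s by apply/derivable1_diffP; case: fd.
have fE : 'D_1 f s = d by case: fd.
split; rewrite /= ?cReM ?cImM /=.
  have := is_derive_comp1 (is_derive_cos (f s)) df fE.
  by move/is_derive_eq; apply; ring.
have := is_derive_comp1 (is_derive_sin (f s)) df fE.
by move/is_derive_eq; apply; ring.
Qed.

Lemma expi_at_deriv (th : angle_fun R) (s d : R) : is_derive_angle th s d ->
  is_derivC (expi_at th) s (1 : R) (d *i * expi_at th s).
Proof.
case: th => [f|t] /=; first exact: expi_deriv.
move=> [f [tf fd]]; have ts : t s = to_circle (f s) by exact: nbhs_singleton tf.
rewrite ts expi_to_circle; apply: near_eq_is_derivC (expi_deriv fd).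
by apply: filterS tf => r /= ->; rewrite expi_to_circle.
Qed.

End Angles.

(** * Linear algebra of Lagrangian frames *)

Section LagrangianFrame.
Variables (R : realType) (n : nat).
Local Notation vec := 'rV[R]_(n + n).

Lemma euclidE (u v : vec) : euclid u v = (u *m v^T) 0 0.
Proof. by rewrite mxE; apply: eq_bigr => i _; rewrite !mxE. Qed.

Lemma euclid_mulmxl (c : 'rV[R]_n) (J : 'M[R]_(n, n + n)) (v : vec) :
  v *m J^T = 0 -> euclid (c *m J) v = 0.
Proof.
move=> vJ; rewrite euclidE -mulmxA -[J *m v^T]trmxK trmx_mul trmxK vJ.
by rewrite trmx0 mulmx0 mxE.
Qed.

(** This identity carries the real definitions of the metric and of the symplectic
    form over to complex matrix algebra. *)
Lemma hermitianE (u v : vec) :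
  \sum_j zcoord u j * conjc (zcoord v j) = euclid u v +i* (- omega u v).
Proof.
apply: complexP; rewrite ?cRe_sum ?cIm_sum.
  rewrite -[RHS]/(euclid u v) (_ : euclid u v = \sum_(j < n)
    (u 0 (lshift n j) * v 0 (lshift n j) + u 0 (rshift n j) * v 0 (rshift n j)));
    last first.
    by rewrite /euclid big_split_ord big_split.
  apply: eq_bigr => j _.
  by rewrite cReM cReJ cImJ mulrN opprK.
rewrite -[RHS]/(- omega u v) /omega -sumrN; apply: eq_bigr => j _.
by rewrite cImM /=; ring.
Qed.

Lemma omegaDl (u v w : vec) : omega (u + v) w = omega u w + omega v w.
Proof. by rewrite /omega -big_split; apply: eq_bigr => j _; rewrite !mxE /=; ring. Qed.

Lemma omegaZl (a : R) (u w : vec) : omega (a *: u) w = a * omega u w.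
Proof. by rewrite /omega mulr_sumr; apply: eq_bigr => j _; rewrite !mxE /=; ring. Qed.

Lemma omegaBl (u v w : vec) : omega (u - v) w = omega u w - omega v w.
Proof. by rewrite omegaDl -[- v]scaleN1r omegaZl mulN1r. Qed.

Lemma omega_suml (I : finType) (f : I -> vec) (w : vec) :
  omega (\sum_i f i) w = \sum_i omega (f i) w.
Proof.
elim: index_enum => [|i r IH].
  by rewrite !big_nil -(scale0r w) omegaZl mul0r.
by rewrite !big_cons omegaDl IH.
Qed.

Lemma omegaC (u v : vec) : omega u v = - omega v u.
Proof. by rewrite /omega -sumrN; apply: eq_bigr => j _; ring. Qed.

Lemma mulmx_rows (c : 'rV[R]_n) (J : 'M[R]_(n, n + n)) :
  c *m J = \sum_i c 0 i *: row i J.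
Proof. by rewrite mulmx_sum_row. Qed.

(** The matrix whose determinant is the value of [dz_1 /\ ... /\ dz_n] on the
    rows of [J]. *)
Definition cframe (J : 'M[R]_(n, n + n)) : 'M[R[i]]_n :=
  \matrix_(i, k) zcoord (row i J) k.

Variable J : 'M[R]_(n, n + n).
Hypothesis lagJ : forall i k, omega (row i J) (row k J) = 0.

Local Notation g := (J *m J^T).

(** For a Lagrangian frame the Gram matrix is the hermitian square of the
    complex frame, since its imaginary part is the symplectic form. *)
Lemma gram_cframe :
  map_mx (real_complex R) g = cframe J *m (map_mx conjc (cframe J))^T.
Proof.
apply/matrixP => i k; rewrite !mxE.
under [RHS]eq_bigr do rewrite !mxE.
rewrite hermitianE lagJ oppr0 complexr0 euclidE; congr (_%:C).
by rewrite !mxE; apply: eq_bigr => j _; rewrite !mxE.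
Qed.

Lemma det_gram_cframe : (\det g)%:C = \det (cframe J) * conjc (\det (cframe J)).
Proof. by rewrite -det_map_mx gram_cframe det_mulmx det_tr det_map_mx. Qed.

(** Hence the volume density of a Lagrangian frame is the modulus of its complex
    determinant, and its Lagrangian angle is the phase. *)
Lemma det_gram_polar (E : R[i]) (rho : R) : E * conjc E = 1 ->
  \det (cframe J) = E * rho%:C -> \det g = rho ^+ 2.
Proof.
move=> E1 dJ; apply: complexI; rewrite -/(real_complex R _) det_gram_cframe dJ.
rewrite rmorphM /= mulrACA E1 mul1r; apply: complexP; rewrite ?cReM ?cImM /=; ring.
Qed.

Lemma gram_unit : \det g != 0 -> g \in unitmx.
Proof. by rewrite unitmxE unitfE. Qed.

Lemma lagrangian_span_omega (c d : 'rV[R]_n) : omega (c *m J) (d *m J) = 0.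
Proof.
rewrite mulmx_rows omega_suml big1 // => i _; rewrite omegaZl omegaC.
rewrite mulmx_rows omega_suml big1 ?oppr0 ?mulr0 // => k _.
by rewrite omegaZl lagJ mulr0.
Qed.

Hypothesis detJ : \det g != 0.

(** Subtracts the orthogonal projection onto the row space of [J]. *)
Definition normal_proj (v : vec) : vec := v - v *m J^T *m invmx g *m J.

Lemma normal_proj_orth v : normal_proj v *m J^T = 0.
Proof.
by rewrite mulmxBl -!mulmxA mulVmx ?gram_unit // mulmx1 subrr.
Qed.

Lemma hermitian_orth_eq0 (N : vec) : N *m J^T = 0 ->
  (forall k, omega N (row k J) = 0) -> N = 0.
Proof.
move=> NJ wNJ; pose z : 'rV[R[i]]_n := \row_j zcoord N j.
have zJ : z *m (map_mx conjc (cframe J))^T = 0.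
  apply/rowP => k; rewrite !mxE; under eq_bigr do rewrite !mxE.
  rewrite hermitianE wNJ oppr0 (_ : euclid N (row k J) = 0) //.
  transitivity ((N *m J^T) 0 k); last by rewrite NJ mxE.
  by rewrite mxE; apply: eq_bigr => j _; rewrite !mxE.
have Ju : (map_mx conjc (cframe J))^T \in unitmx.
  rewrite unitmxE det_tr det_map_mx unitfE conjc_eq0.
  apply: contraNneq detJ => d0; have := det_gram_cframe.
  by rewrite d0 mul0r => /complexI ->.
have z0 : z = 0 by rewrite -[z](mulmxK Ju) zJ mul0mx.
have zN j : zcoord N j = 0.
  by have := congr1 (fun A : 'rV[R[i]]_n => A 0 j) z0; rewrite !mxE.
apply/rowP => i; rewrite [RHS]mxE.
by case: (split_ordP i) => j ->; have := zN j; case.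
Qed.

(** A Lagrangian subspace is its own symplectic orthogonal: the normal part of a
    vector in this orthogonal is hermitian-orthogonal to a complex basis. *)
Lemma lagrangian_maximal (v : vec) :
  (forall k, omega v (row k J) = 0) -> exists c, v = c *m J.
Proof.
move=> vJ; exists (v *m J^T *m invmx g); apply/eqP; rewrite -subr_eq0.
apply/eqP/hermitian_orth_eq0 => [|k]; first exact: normal_proj_orth.
by rewrite omegaBl vJ rowE lagrangian_span_omega subrr.
Qed.

End LagrangianFrame.

(** * Lagrangian submanifolds with a global parametrization *)

Section GlobalLagrangian.
Variables (R : realType) (n : nat) (L : set 'rV[R]_(n + n)).
Variables (V : set 'rV[R]_n) (Phi : 'rV[R]_n -> 'rV[R]_(n + n)).
Hypotheses (openV : open V) (diffeoPhi : diffeomorphism V L Phi).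
Hypothesis lagPhi : forall u, V u ->
  forall i k, omega (row i ('J Phi u)) (row k ('J Phi u)) = 0.
Variables (E : 'rV[R]_n -> R[i]) (rho : 'rV[R]_n -> R).
Hypothesis normE : forall u, V u -> E u * conjc (E u) = 1.
Hypothesis rho_gt0 : forall u, V u -> 0 < rho u.
Hypothesis detPhi : forall u, V u ->
  \det (cframe ('J Phi u)) = E u * (rho u)%:C.

Let param : local_param L V Phi.
Proof. exact: diffeomorphism_local_param. Qed.

Let preimage p : L p -> exists2 u, V u & Phi u = p.
Proof.
by have [g [_ _ _ Lg]] := diffeoPhi; move=> /Lg[Vg gp]; exists (g p).
Qed.

Let Phi_inj u u' : V u -> V u' -> Phi u = Phi u' -> u = u'.
Proof.
have [g [_ _ gV _]] := diffeoPhi => /gV[_ gu] /gV[_ gu'] e.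
by rewrite -gu e gu'.
Qed.

Let det_metric u : V u -> \det (metric Phi u) = rho u ^+ 2.
Proof.
by move=> Vu; apply: det_gram_polar (detPhi Vu); [exact: lagPhi|exact: normE].
Qed.

Let det_metric_neq0 u : V u -> \det (metric Phi u) != 0.
Proof. by move=> Vu; rewrite det_metric // expf_neq0 // gt_eqF // rho_gt0. Qed.

Lemma global_lagrangian : lagrangian L.
Proof.
split; first exact: diffeomorphism_embedded diffeoPhi.
move=> p v w /preimage[u Vu <-] /(tangentE _ param Vu)[c ->].
move=> /(tangentE _ param Vu)[d ->].
by apply: lagrangian_span_omega; exact: lagPhi.
Qed.

Lemma global_lagrangian_angle (Theta : 'rV[R]_(n + n) -> circle R) :
  (forall u, V u -> expi_circle (Theta (Phi u)) = E u) -> lagrangian_angle L Theta.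
Proof.
move=> ThetaE; exists [set x | x = (V, Phi)].
  split=> [_ _ [-> ->] //|p /preimage[u Vu up]|_ _ _ _ [-> ->] [-> ->] u u' Vu Vu' e].
    by exists V, Phi; split=> //; exists u.
  by exists 1%:M; rewrite det1 ltr01 mul1mx (Phi_inj Vu Vu' e).
move=> _ _ u [-> ->] Vu.
rewrite ThetaE // det_metric // sqrtr_sqr gtr0_norm ?rho_gt0 //.
exact: detPhi.
Qed.

(** The mean curvature vector is the normal part of the trace of the second
    derivatives. It agrees with the normal part of [T] as soon as the difference of
    the two vectors is tangent, and on a Lagrangian tangency is tested by the
    symplectic form. *)
Lemma global_translating_soliton (T : 'rV[R]_(n + n)) :
  (forall u, V u -> forall k,
    omega (\sum_i \sum_j
             invmx (metric Phi u) i j *: partial i (partial j Phi) u)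
          (row k ('J Phi u)) = omega T (row k ('J Phi u))) ->
  translating_soliton n L T.
Proof.
move=> HT; split; first exact: diffeomorphism_embedded diffeoPhi.
move=> p /preimage[u Vu <-].
set H := normal_proj ('J Phi u) T.
have orthH t : tangent n L (Phi u) t -> euclid t H = 0.
  move=> /(tangentE _ param Vu)[c ->]; apply: euclid_mulmxl.
  by apply: normal_proj_orth; exact: det_metric_neq0.
have TH : T - H = T *m ('J Phi u)^T *m invmx (metric Phi u) *m 'J Phi u.
  by rewrite /H /normal_proj subKr.
exists H; last by split=> //; rewrite TH; apply/(tangentE _ param Vu); eexists.
exists V, Phi, u; split=> //; split=> //; apply/(tangentE _ param Vu).
set S := \sum_i _; have [c Sc] : exists c, S - T = c *m 'J Phi u.
  apply: lagrangian_maximal; [exact: lagPhi|exact: det_metric_neq0|].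
  by move=> k; rewrite omegaBl HT // subrr.
exists (c + T *m ('J Phi u)^T *m invmx (metric Phi u)).
by rewrite mulmxDl -Sc -TH addrA subrK.
Qed.

End GlobalLagrangian.

(** * The system of differential equations *)

Section Solution.
Variables (R : realType) (m : nat) (lambda : 'I_m -> R) (alpha : R) (I : set R).
Hypotheses (openI : open I) (itvI : is_interval I).
Variables (theta : angle_fun R) (w : 'I_m -> R -> R[i]) (beta : R -> R[i]).
Hypothesis smooth_w : forall j, smooth_curveC I (w j).
Hypothesis w_neq0 : forall j s, I s -> w j s != 0.

Local Notation E := (expi_at theta).

Definition wdot j s : R[i] :=
  (lambda j)%:C * E s * conjc (\prod_(k < m | k != j) w k s).
Definition betadot s : R[i] := E s * conjc (\prod_(k < m) w k s).

Hypothesis w_ode : forall j s, I s -> is_deriveC (w j) s (wdot j s).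
Hypothesis theta_ode : forall s, I s ->
  is_derive_angle theta s
    (alpha * complex.Im (conjc (E s) * \prod_(k < m) w k s)).
Hypothesis beta_ode : forall s, I s -> is_deriveC beta s (betadot s).

(** The squared modulus as an element of [R], whereas the norm of [R[i]] takes its
    values in [R[i]]. *)
Definition sqnorm (z : R[i]) : R := complex.Re z ^+ 2 + complex.Im z ^+ 2.

Lemma sqnormE z : (sqnorm z)%:C = z * conjc z.
Proof. by case: z => a b; apply: complexP; rewrite ?cReM ?cImM /sqnorm /=; ring. Qed.

Lemma sqnorm_gt0 z : z != 0 -> 0 < sqnorm z.
Proof.
case: z => a b; rewrite eq_complex /= negb_and => ab.
rewrite lt_def addr_ge0 ?sqr_ge0 // andbT paddr_eq0 ?sqr_ge0 // !sqrf_eq0.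
by rewrite negb_and.
Qed.

Lemma sqnormM y z : sqnorm (y * z) = sqnorm y * sqnorm z.
Proof. by rewrite /sqnorm cReM cImM; ring. Qed.

Lemma sqnormJ z : sqnorm (conjc z) = sqnorm z.
Proof. by rewrite /sqnorm cReJ cImJ sqrrN. Qed.

Lemma prod_neq0 s : I s -> \prod_(k < m) w k s != 0.
Proof. by move=> Is; apply/prodf_neq0 => k _; exact: w_neq0. Qed.

Lemma E_neq0 s : E s != 0.
Proof.
apply: contra_eqN (expi_at_norm theta s) => /eqP ->.
by rewrite mul0r eq_sym oner_neq0.
Qed.

Lemma betadot_neq0 s : I s -> betadot s != 0.
Proof. by move=> Is; rewrite mulf_neq0 ?E_neq0 // conjc_eq0 prod_neq0. Qed.

(** The key relation of the system. Its real part says that all the functions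
    [|w_j|^2 / lambda_j] have the same derivative as [2 Re beta]; it also cancels
    all the mixed terms of the metric and of the symplectic form. *)
Lemma wdot_conj j s : wdot j s * conjc (w j s) = (lambda j)%:C * betadot s.
Proof.
rewrite /wdot /betadot [in RHS](bigD1 j) //= rmorphM /=; ring.
Qed.

Lemma wdotE j s : w j s != 0 -> wdot j s / w j s =
  (lambda j / sqnorm (w j s))%:C * betadot s.
Proof.
move=> wj; have wcj : conjc (w j s) != 0 by rewrite conjc_eq0.
have -> : wdot j s = (lambda j)%:C * betadot s / conjc (w j s).
  by rewrite -wdot_conj mulfK.
rewrite rmorphM fmorphV /= sqnormE; field; by rewrite wj wcj.
Qed.

Definition logsum s : R := \sum_(k < m) lambda k / sqnorm (w k s).

(** The derivative of [betadot], that is [conj Q'] for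
    [Q = e^(-i theta) w_1 ... w_m]: the first term comes from the variation of the
    angle, whose equation is [theta' = - alpha Im betadot]. *)
Definition betaddot s : R[i] :=
  (- alpha * complex.Im (betadot s)) *i * betadot s +
  (sqnorm (betadot s) * logsum s)%:C.

Lemma betadot_deriv s : I s -> is_derivC betadot s (1 : R) (betaddot s).
Proof.
move=> Is; have dE := expi_at_deriv (theta_ode Is).
have dP := is_derivC_logprod (index_enum _) (f := w) (fun k => w_neq0 k Is)
  (fun k => w_ode k Is).
apply: is_derivC_eq (is_derivCM dE (is_derivCJ dP)) _.
have imE : complex.Im (conjc (E s) * \prod_(k < m) w k s) =
    - complex.Im (betadot s).
  by rewrite -cImJ /betadot rmorphM /= conjcK.
rewrite imE mulrN -mulNr -mulrA -/(betadot s) /betaddot; congr (_ + _).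
rewrite rmorphM mulrA -/(betadot s) rmorphM /= sqnormE -[RHS]mulrA; congr (_ * _).
rewrite /logsum !rmorph_sum mulr_sumr; apply: eq_bigr => k _.
by rewrite wdotE ?w_neq0 // rmorphM /= oppr0 mulrC.
Qed.

(** The imaginary part of [betadot] satisfies the linear equation
    [y' = - alpha (Re beta)' y], which integrates to the formula below; hence it
    vanishes everywhere or nowhere. *)
Lemma Im_betadotE s0 s : I s0 -> I s ->
  complex.Im (betadot s) * expR (alpha * complex.Re (beta s)) =
  complex.Im (betadot s0) * expR (alpha * complex.Re (beta s0)).
Proof.
move=> Is0 Is.
pose y t := complex.Im (betadot t) * expR (alpha * complex.Re (beta t)).
suff dy0 t : I t -> is_derive t (1 : R) y 0.
  exact: (interval_derive0_cst itvI dy0 Is Is0).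
move=> It.
have [_ dy] := betadot_deriv It; have [db _] := beta_ode It.
have dab : is_derive t 1 (fun s => complex.Re (beta s) * alpha)
    (complex.Re (betadot t) * alpha) by exact: is_deriveMr.
have dabd : differentiable (fun s => complex.Re (beta s) * alpha) t.
  by apply/derivable1_diffP; case: dab.
have [_ dabE] := dab.
have de := is_derive_comp1 (is_derive_expR _) dabd dabE.
have := is_derive_leibniz dy de; rewrite (_ : (fun t => _) = y); last first.
  by apply/funext => u; rewrite /y mulrC [_ * alpha]mulrC mulrC.
move/is_derive_eq; apply; rewrite /betaddot cImD cImM /=; ring.
Qed.

Lemma sqnorm_w_deriv j s : I s ->
  is_derive s 1 (fun t => sqnorm (w j t)) (2 * lambda j * complex.Re (betadot s)).
Proof.
move=> Is; have [d1 d2] := w_ode j Is.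
have := is_deriveD (is_derive_leibniz d1 d1) (is_derive_leibniz d2 d2).
move/is_derive_eq; apply.
have := congr1 (@complex.Re R) (wdot_conj j s); rewrite cReMJ cReMr => H.
by rewrite -mulrA -H; ring.
Qed.

Definition wddot j s : R[i] :=
  'D_1 (fun t => complex.Re (wdot j t)) s +i* 'D_1 (fun t => complex.Im (wdot j t)) s.

Lemma wdot_deriv j s : I s -> is_derivC (wdot j) s (1 : R) (wddot j s).
Proof.
move=> Is; have [smR smI] := smooth_w j; have [d1 d2] := (smR 1%N s Is, smI 1%N s Is).
split; apply: derivableP.
  apply: near_eq_derivable d1; apply: (near_open openI Is) => t It.
  by rewrite derive1n1 derive1E; have [[_ ->] _] := w_ode j It.
apply: near_eq_derivable d2; apply: (near_open openI Is) => t It.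
by rewrite derive1n1 derive1E; have [_ [_ ->]] := w_ode j It.
Qed.

(** The key relation [wdot_conj], differentiated; it replaces an explicit formula
    for the second derivative of [w_j]. *)
Lemma wddot_conj j s : I s ->
  wddot j s * conjc (w j s) + wdot j s * conjc (wdot j s) =
  (lambda j)%:C * betaddot s.
Proof.
move=> Is.
have d1 := is_derivCM (wdot_deriv j Is) (is_derivCJ (w_ode j Is)).
have d2 := is_derivCM (is_derivC_cst (lambda j)%:C s (1 : R)) (betadot_deriv Is).
rewrite mul0r add0r in d2; apply: is_derivC_unique d2.
apply: near_eq_is_derivC d1.
by near=> t; exact: wdot_conj.
Unshelve. all: by end_near. Qed.

End Solution.

(** * The parametrization is a diffeomorphism *)

Lemma ofC_Re (R : realType) n (z : 'rV[R[i]]_n) j :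
  ofC z 0 (lshift n j) = complex.Re (z 0 j).
Proof. by rewrite row_mxEl mxE. Qed.

Lemma ofC_Im (R : realType) n (z : 'rV[R[i]]_n) j :
  ofC z 0 (rshift n j) = complex.Im (z 0 j).
Proof. by rewrite row_mxEr mxE. Qed.

Lemma zcoord_ofC (R : realType) n (z : 'rV[R[i]]_n) j : zcoord (ofC z) j = z 0 j.
Proof. by rewrite /zcoord ofC_Re ofC_Im; case: (z 0 j). Qed.

Section Parametrization.
Variables (R : realType) (m : nat) (lambda : 'I_m -> R) (alpha : R) (I : set R).
Hypotheses (openI : open I) (itvI : is_interval I).
Variables (theta : angle_fun R) (w : 'I_m -> R -> R[i]) (beta : R -> R[i]).
Hypothesis smooth_w : forall j, smooth_curveC I (w j).
Hypothesis w_neq0 : forall j s, I s -> w j s != 0.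
Hypothesis smooth_beta : smooth_curveC I beta.

Local Notation N := (m + 1)%N.
Local Notation E := (expi_at theta).
Local Notation lastc := (rshift m (ord0 : 'I_1)).
Local Notation point := (soliton_point lambda w beta).
Local Notation betadot := (betadot theta w).

Lemma point_Re_l x s j : point x s 0 (lshift N (lshift 1 j)) =
  x 0 j * complex.Re (w j s).
Proof. by rewrite ofC_Re row_mxEl mxE cReMr. Qed.

Lemma point_Im_l x s j : point x s 0 (rshift N (lshift 1 j)) =
  x 0 j * complex.Im (w j s).
Proof. by rewrite ofC_Im row_mxEl mxE cImMr. Qed.

Lemma point_Re_r x s : point x s 0 (lshift N lastc) =
  - 2^-1 * (\sum_(j < m) lambda j * x 0 j ^+ 2) + complex.Re (beta s).
Proof. by rewrite ofC_Re row_mxEr mxE eqxx mulr1n cReD. Qed.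

Lemma point_Im_r x s : point x s 0 (rshift N lastc) = complex.Im (beta s).
Proof. by rewrite ofC_Im row_mxEr mxE eqxx mulr1n cImD /= add0r. Qed.

Section Smoothness.
Variables (p : nat) (U : set 'rV[R]_p) (tau : 'rV[R]_p -> R).
Hypotheses (openU : open U) (tauI : forall u, U u -> I (tau u)).
Hypothesis smooth_tau : forall k, Ck (@stdbasis R p) U k tau.

Lemma Ck_curve_comp (f : R -> R) k :
  smooth_curve I f -> Ck (@stdbasis R p) U k (fun u => f (tau u)).
Proof.
by move=> sf; exact: (Ck_comp openU tauI (smooth_curve_Ck sf k) (smooth_tau k)).
Qed.

Lemma Ck_sqnorm_w j k : Ck (@stdbasis R p) U k (fun u => sqnorm (w j (tau u))).
Proof.
have [sR sI] := smooth_w j.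
by apply: CkD => //; apply: CkX => //; [exact: Ck_curve_comp sR|exact: Ck_curve_comp sI].
Qed.

End Smoothness.

Lemma smooth_on_point (U : set 'rV[R]_N) (tau : 'rV[R]_N -> R) :
  open U -> (forall u, U u -> I (tau u)) ->
  (forall k, Ck (@stdbasis R N) U k tau) ->
  smooth_on U (fun u => point (lsubmx u) (tau u)).
Proof.
move=> oU tauI smt; apply: Ck_smooth_on => k; apply: Ck_row => // i.
have cx j : Ck (@stdbasis R N) U k (fun u => lsubmx u 0 j).
  by apply: Ck_ext (Ck_coord _ k (lshift 1 j) oU) => // u _; rewrite mxE.
case: (split_ordP i) => {}i ->; case: (split_ordP i) => j ->.
- have [sR _] := smooth_w j.
  apply: Ck_ext (CkM oU (cx j) (Ck_curve_comp oU tauI smt k sR)) => // u _.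
  by rewrite point_Re_l.
- have [sR _] := smooth_beta.
  have cS : Ck (@stdbasis R N) U k
      (fun u => - 2^-1 * \sum_(j < m) lambda j * lsubmx u 0 j ^+ 2).
    apply: CkMl => //; apply: Ck_sum => // l.
    by apply: CkMl => //; exact: CkX.
  apply: Ck_ext (CkD oU cS (Ck_curve_comp oU tauI smt k sR)) => // u _.
  by rewrite (ord1 j) point_Re_r.
- have [_ sI] := smooth_w j.
  apply: Ck_ext (CkM oU (cx j) (Ck_curve_comp oU tauI smt k sI)) => // u _.
  by rewrite point_Im_l.
- have [_ sI] := smooth_beta.
  apply: Ck_ext (Ck_curve_comp oU tauI smt k sI) => // u _.
  by rewrite (ord1 j) point_Im_r.
Qed.

(** The left inverse of the parametrization once the time [t] of a point is known,
    [x_j] being the real number [z_j / w_j t]. The last coordinate [t'] is left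
    free for the reparametrizations of [I]. *)
Definition chart (z : 'rV[R]_(N + N)) (t t' : R) : 'rV[R]_N :=
  row_mx (\row_j ((z 0 (lshift N (lshift 1 j)) * complex.Re (w j t) +
                   z 0 (rshift N (lshift 1 j)) * complex.Im (w j t)) /
                  sqnorm (w j t))) (t')%:M.

Lemma chart_point x s t' : I s -> chart (point x s) s t' = row_mx x (t')%:M.
Proof.
move=> Is; congr row_mx; apply/rowP => j; rewrite mxE point_Re_l point_Im_l.
rewrite -[in RHS](mulfK (lt0r_neq0 (sqnorm_gt0 (w_neq0 j Is))) (x 0 j)).
by rewrite /sqnorm; congr (_ / _); ring.
Qed.

Lemma smooth_on_chart (W : set 'rV[R]_(N + N)) (tau : 'rV[R]_(N + N) -> R)
    (eta : R -> R) :
  open W -> (forall z, W z -> I (tau z)) ->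
  (forall k, Ck (@stdbasis R (N + N)) W k tau) ->
  (forall k, Ck [set (1 : R)] I k eta) ->
  smooth_on W (fun z => chart z (tau z) (eta (tau z))).
Proof.
move=> oW tauI smt sme; apply: Ck_smooth_on => k; apply: Ck_row => // i.
case: (split_ordP i) => j ->; last first.
  apply: Ck_ext (Ck_comp oW tauI (sme k) (smt k)) => // z _.
  by rewrite row_mxEr (ord1 j) mxE eqxx mulr1n.
have [sR sI] := smooth_w j.
have cc := Ck_coord (@stdbasis R (N + N)) k _ oW.
have n0 z : W z -> sqnorm (w j (tau z)) != 0.
  by move=> Wz; rewrite gt_eqF // sqnorm_gt0 // w_neq0 //; exact: tauI.
have := Ck_div oW n0 (CkD oW
  (CkM oW (cc (lshift N (lshift 1 j))) (Ck_curve_comp oW tauI smt k sR))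
  (CkM oW (cc (rshift N (lshift 1 j))) (Ck_curve_comp oW tauI smt k sI)))
  (Ck_sqnorm_w oW tauI smt j k).
by apply: Ck_ext => // z _; rewrite row_mxEl mxE.
Qed.

Hypothesis w_ode : forall j s, I s -> is_deriveC (w j) s (wdot lambda theta w j s).
Hypothesis theta_ode : forall s, I s ->
  is_derive_angle theta s
    (alpha * complex.Im (conjc (E s) * \prod_(k < m) w k s)).
Hypothesis beta_ode : forall s, I s -> is_deriveC beta s (betadot s).

(** A smooth function that recovers [s] from the point of parameters [(x, s)]. *)
Definition time_function (W : set 'rV[R]_(N + N)) (sigma : 'rV[R]_(N + N) -> R) :=
  [/\ open W, forall k, Ck (@stdbasis R (N + N)) W k sigma,
      forall z, W z -> I (sigma z) &
      forall x s, I s -> W (point x s) /\ sigma (point x s) = s].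

(** By [Im_betadotE], if [Im betadot] is nonzero at one time it never vanishes, so
    that [Im beta] is strictly monotone; as it is the imaginary part of the last
    coordinate of a point, it determines the time. *)
Lemma time_function_Im s0 : I s0 -> complex.Im (betadot s0) != 0 ->
  exists W sigma, time_function W sigma.
Proof.
move=> Is0 c0; set c := complex.Im (betadot s0) in c0.
have sgn s : I s -> 0 < c * complex.Im (betadot s).
  move=> Is.
  have H := Im_betadotE itvI w_neq0 w_ode theta_ode beta_ode Is0 Is.
  rewrite -(pmulr_lgt0 _ (expR_gt0 (alpha * complex.Re (beta s)))) -mulrA H.
  by rewrite mulrA mulr_gt0 ?expR_gt0 // -expr2 lt_def sqr_ge0 sqrf_eq0 c0.
have [_ sI] := smooth_beta.
(* The equation [Im beta s = Im z_n], multiplied by [c] to make it increasing. *)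
pose B (l : bool) (s : R) : R := if l then c * complex.Im (beta s) else 1.
pose C (l : bool) (z : 'rV[R]_(N + N)) : R :=
  if l then 1 else - c * z 0 (rshift N lastc).
have smB l k : Ck [set (1 : R)] I k (B l).
  case: l; last exact: (Ck_cst _ openI k (1 : R)).
  by apply: CkMl => //; exact: (smooth_curve_Ck sI k).
have smC l k : Ck (@stdbasis R (N + N)) setT k (C l).
  case: l; first exact: (Ck_cst _ openT k (1 : R)).
  by apply: CkMl; [exact: openT|exact: (Ck_coord _ k _ openT)].
have [] := separated_implicit openI itvI smB smC.
  move=> z s Is; rewrite big_bool /= /C mulr1 derive_cst mul0r addr0.
  have [_ [db dbE]] := beta_ode Is.
  rewrite (_ : B true = c \*: (fun t => complex.Im (beta t))) // deriveZ // dbE.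
  exact: sgn.
move=> W [sigma [oW sms Isig sol]]; exists W, sigma; split=> // x s Is.
by apply: sol => //; rewrite big_bool /= /B /C point_Im_r; ring.
Qed.

(** This covers the case where [Im betadot] vanishes identically. A point and its
    time satisfy [Re z_n = Re (beta s) - sum_j lambda_j |z_j|^2 / (2 |w_j s|^2)];
    as [|w_j|^2] has derivative [2 lambda_j Re betadot], all the terms depending on
    [s] have derivatives of the sign of [Re betadot], and this equation determines
    [s]. *)
Lemma time_function_Re : (forall s, I s -> complex.Re (betadot s) != 0) ->
  exists W sigma, time_function W sigma.
Proof.
move=> r0; have dbd s (Is : I s) := betadot_deriv w_neq0 w_ode theta_ode Is.
have [e sgn] : exists e, forall s, I s -> 0 < e * complex.Re (betadot s).
  by apply: (interval_nonzero_sign itvI) => // s Is; have [[]] := dbd s Is.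
have [sR _] := smooth_beta.
(* [inl true] and [inl false] index [Re beta s] and [Re z_n]. *)
pose B (l : bool + 'I_m) (s : R) : R :=
  match l with
  | inr j => - (e * lambda j / 2) * (sqnorm (w j s))^-1
  | inl true => e * complex.Re (beta s)
  | inl false => 1
  end.
pose C (l : bool + 'I_m) (z : 'rV[R]_(N + N)) : R :=
  match l with
  | inr j => z 0 (lshift N (lshift 1 j)) ^+ 2 + z 0 (rshift N (lshift 1 j)) ^+ 2
  | inl true => 1
  | inl false => - e * z 0 (lshift N lastc)
  end.
have n0 j s : I s -> sqnorm (w j s) != 0.
  by move=> Is; rewrite gt_eqF // sqnorm_gt0 // w_neq0.
have smn j k : Ck [set (1 : R)] I k (fun s => sqnorm (w j s)).
  have [wR wI] := smooth_w j.
  by apply: CkD => //; apply: CkX => //;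
    [exact: (smooth_curve_Ck wR k)|exact: (smooth_curve_Ck wI k)].
have smB l k : Ck [set (1 : R)] I k (B l).
  case: l => [[]|j].
  - by apply: CkMl => //; exact: (smooth_curve_Ck sR k).
  - exact: (Ck_cst _ openI k (1 : R)).
  - by apply: CkMl => //; apply: CkV => // s; exact: n0.
have cc := Ck_coord (@stdbasis R (N + N)) _ _ openT.
have smC l k : Ck (@stdbasis R (N + N)) setT k (C l).
  case: l => [[]|j].
  - exact: (Ck_cst _ openT k (1 : R)).
  - by apply: CkMl; [exact: openT|exact: cc].
  - by apply: CkD; [exact: openT| |]; apply: CkX;
      [exact: openT|exact: cc|exact: openT|exact: cc].
have [] := separated_implicit openI itvI smB smC.
  move=> z s Is; rewrite big_sumType big_bool /= mulr1 derive_cst mul0r addr0.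
  have [[db dbE] _] := beta_ode Is.
  rewrite (_ : B (inl true) = e \*: (fun t => complex.Re (beta t))) // deriveZ // dbE.
  apply: (lt_le_trans (sgn s Is)); rewrite lerDl sumr_ge0 // => j _.
  have [dn dnE] := sqnorm_w_deriv w_ode j Is.
  have dV : derivable (fun t => (sqnorm (w j t))^-1) s 1.
    by apply: derivableV => //; exact: n0.
  rewrite (_ : B (inr j) =
    - (e * lambda j / 2) \*: (fun t => (sqnorm (w j t))^-1)) //.
  rewrite deriveZ // deriveV ?n0 // dnE.
  rewrite mulr_ge0 ?addr_ge0 ?sqr_ge0 //.
  rewrite (_ : _ *: _ =
    (e * complex.Re (betadot s)) * (lambda j / sqnorm (w j s)) ^+ 2).
    by rewrite mulr_ge0 ?sqr_ge0 // ltW // sgn.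
  have n0s := n0 j s Is.
  rewrite -[LHS]/(- (e * lambda j / 2) *
    (- sqnorm (w j s) ^- 2 * (2 * lambda j * complex.Re (betadot s)))).
  by field.
move=> W [sigma [oW sms Isig sol]]; exists W, sigma; split=> // x s Is.
apply: sol => //; rewrite big_sumType big_bool /= /B /C point_Re_r.
rewrite [X in _ + X = _]
  (eq_bigr (fun j => - (e / 2) * (lambda j * x 0 j ^+ 2))); last first.
  move=> j _; rewrite point_Re_l point_Im_l.
  have n0s := n0 j s Is.
  rewrite (_ : _ + _ = x 0 j ^+ 2 * sqnorm (w j s)); last by rewrite /sqnorm; ring.
  by field.
by rewrite -mulr_sumr; field.
Qed.

Lemma time_functionP : I !=set0 -> exists W sigma, time_function W sigma.
Proof.
move=> [s0 Is0].
have [c0|c0] := eqVneq (complex.Im (betadot s0)) 0; last first.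
  exact: time_function_Im Is0 c0.
apply: time_function_Re => s Is; apply/eqP => r0.
have /eqP : betadot s != 0 by apply: betadot_neq0 Is; exact: w_neq0.
apply; apply: complexP; rewrite ?r0 //=.
have := Im_betadotE itvI w_neq0 w_ode theta_ode beta_ode Is0 Is.
by rewrite c0 mul0r => /eqP; rewrite mulf_eq0 expR_eq0 orbF => /eqP.
Qed.

Definition param_dom : set 'rV[R]_N := [set u | I (u 0 lastc)].

Definition Phi (u : 'rV[R]_N) := point (lsubmx u) (u 0 lastc).

Lemma open_param_dom : open param_dom.
Proof.
apply: (@open_comp _ _ (fun u : 'rV[R]_N => u 0 lastc)) => // u _.
exact: coord_continuous.
Qed.

Lemma row_lastc (u : 'rV[R]_N) : row_mx (lsubmx u) (u 0 lastc)%:M = u.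
Proof.
rewrite -[RHS]hsubmxK; congr row_mx; apply/rowP => j.
by rewrite (ord1 j) !mxE eqxx mulr1n.
Qed.

Lemma smooth_map_on p q (A U : set 'rV[R]_p) (f : 'rV[R]_p -> 'rV[R]_q) :
  open U -> A `<=` U -> smooth_on U f -> smooth_map A f.
Proof. by move=> oU AU sf x Ax; exists U, f; split=> //; exact: AU. Qed.

Lemma diffeomorphism_Phi : I !=set0 ->
  diffeomorphism param_dom (soliton_set I lambda w beta) Phi.
Proof.
move=> I0; have [W [sigma [oW sms Isig sol]]] := time_functionP I0.
exists (fun z => chart z (sigma z) (sigma z)); split.
- apply: smooth_map_on open_param_dom _ _ => //.
  apply: smooth_on_point => // [|k]; first exact: open_param_dom.
  exact: (Ck_coord _ k _ open_param_dom).
- apply: (smooth_map_on oW) => [_ [x [s [Is ->]]]|]; first by case: (sol x s Is).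
  apply: (smooth_on_chart (eta := id)) => // k; exact: (Ck_id k openI).
- move=> u Iu; split; first by exists (lsubmx u), (u 0 lastc).
  have [_ su] := sol (lsubmx u) _ Iu.
  by rewrite /Phi su chart_point // row_lastc.
- move=> _ [x [s [Is ->]]]; have [_ ->] := sol x s Is.
  by rewrite chart_point // /param_dom /Phi /= row_mxKl row_mxEr mxE eqxx mulr1n.
Qed.

(** The chart composed with a diffeomorphism from [I] onto the line. *)
Lemma diffeomorphic_soliton : I !=set0 ->
  diffeomorphic (soliton_set I lambda w beta) [set: 'rV[R]_N].
Proof.
move=> I0; have [W [sigma [oW sms Isig sol]]] := time_functionP I0.
have [eta [kappa [sme smk Ik ke]]] := interval_chartP openI itvI I0.
exists (fun z => chart z (sigma z) (eta (sigma z))).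
exists (fun u => point (lsubmx u) (kappa (u 0 lastc))); split.
- apply: (smooth_map_on oW) => [_ [x [s [Is ->]]]|]; first by case: (sol x s Is).
  exact: smooth_on_chart.
- apply: smooth_map_on openT _ _ => //.
  apply: smooth_on_point => [|u _|k]; [exact: openT|by case: (Ik (u 0 lastc))|].
  by apply: (Ck_comp openT _ (smk k)) => //; exact: (Ck_coord _ k _ openT).
- move=> _ [x [s [Is ->]]]; split=> //; have [_ ->] := sol x s Is.
  by rewrite chart_point // row_mxKl row_mxEr mxE eqxx mulr1n ke.
- move=> u _; have [Iku kku] := Ik (u 0 lastc).
  split; first by exists (lsubmx u), (kappa (u 0 lastc)).
  have [_ su] := sol (lsubmx u) _ Iku.
  by rewrite su chart_point // kku row_lastc.
Qed.

End Parametrization.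

(** * First and second derivatives of the parametrization *)

Lemma is_derive_ofC (R : realType) (V : normedModType R) n
    (f : V -> 'rV[R[i]]_n) (x v : V) (d : 'rV[R[i]]_n) :
  (forall j, is_derivC (fun y => f y 0 j) x v (d 0 j)) ->
  is_derive x v (fun y => ofC (f y)) (ofC d).
Proof.
move=> fd.
have df i : is_derive x v (fun y => ofC (f y) 0 i) (ofC d 0 i).
  case: (split_ordP i) => j ->; have [d1 d2] := fd j.
    by rewrite ofC_Re; under eq_fun do rewrite ofC_Re.
  by rewrite ofC_Im; under eq_fun do rewrite ofC_Im.
have dV : derivable (fun y => ofC (f y)) x v.
  by apply/derivable_mxP => i j; rewrite (ord1 i); case: (df j).
apply: DeriveDef => //; rewrite derive_mx //; apply/rowP => j.
by rewrite mxE; case: (df j).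
Qed.

Definition herm (R : realType) n (a b : 'rV[R[i]]_n) : R[i] :=
  \sum_j a 0 j * conjc (b 0 j).

Lemma hermE (R : realType) n (a b : 'rV[R[i]]_n) :
  herm a b = euclid (ofC a) (ofC b) +i* (- omega (ofC a) (ofC b)).
Proof. by rewrite -hermitianE; apply: eq_bigr => j _; rewrite !zcoord_ofC. Qed.

Lemma omega_ofC (R : realType) n (a b : 'rV[R[i]]_n) :
  omega (ofC a) (ofC b) = - complex.Im (herm a b).
Proof. by rewrite hermE opprK. Qed.

Section Geometry.
Variables (R : realType) (m : nat) (lambda : 'I_m -> R) (alpha : R) (I : set R).
Hypothesis openI : open I.
Variables (theta : angle_fun R) (w : 'I_m -> R -> R[i]) (beta : R -> R[i]).
Hypothesis smooth_w : forall j, smooth_curveC I (w j).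
Hypothesis w_neq0 : forall j s, I s -> w j s != 0.

Local Notation N := (m + 1)%N.
Local Notation E := (expi_at theta).
Local Notation lastc := (rshift m (ord0 : 'I_1)).
Local Notation betadot := (betadot theta w).
Local Notation wdot := (wdot lambda theta w).
Local Notation betaddot := (betaddot lambda alpha theta w).
Local Notation wddot := (wddot lambda theta w).
Local Notation Phi := (Phi lambda w beta).

Hypothesis w_ode : forall j s, I s -> is_deriveC (w j) s (wdot j s).
Hypothesis theta_ode : forall s, I s ->
  is_derive_angle theta s
    (alpha * complex.Im (conjc (E s) * \prod_(k < m) w k s)).
Hypothesis beta_ode : forall s, I s -> is_deriveC beta s (betadot s).

Definition weighted (a b : 'rV[R]_N) : R :=
  \sum_(j < m) lambda j * a 0 (lshift 1 j) * b 0 (lshift 1 j).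

(** The derivative of the parametrization at [u] along [v], in complex coordinates. *)
Definition Phi1 (u v : 'rV[R]_N) : 'rV[R[i]]_N :=
  row_mx (\row_j ((v 0 (lshift 1 j))%:C * w j (u 0 lastc) +
                  (u 0 (lshift 1 j) * v 0 lastc)%:C * wdot j (u 0 lastc)))
         ((- weighted u v)%:C + (v 0 lastc)%:C * betadot (u 0 lastc))%:M.

(** The second derivative of the parametrization at [u] along [v] and [v']. *)
Definition Phi2 (u v v' : 'rV[R]_N) : 'rV[R[i]]_N :=
  row_mx (\row_j ((v 0 (lshift 1 j) * v' 0 lastc +
                   v' 0 (lshift 1 j) * v 0 lastc)%:C * wdot j (u 0 lastc) +
                  (u 0 (lshift 1 j) * (v 0 lastc * v' 0 lastc))%:C *
                    wddot j (u 0 lastc)))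
         ((- weighted v v')%:C +
          (v 0 lastc * v' 0 lastc)%:C * betaddot (u 0 lastc))%:M.

Lemma is_derive_coord (u v : 'rV[R]_N) k :
  is_derive u v (fun y : 'rV[R]_N => y 0 k) (v 0 k).
Proof.
have dk : differentiable (fun y : 'rV[R]_N => y 0 k) u by exact: differentiable_coord.
apply: DeriveDef; first exact: diff_derivable.
have := @derive_mx R _ 1 N id u v (@derivable_id _ _ u v).
by rewrite derive_id => /matrixP/(_ 0 k); rewrite !mxE.
Qed.

Lemma is_derivC_time (f : R -> R[i]) (u v : 'rV[R]_N) d :
  is_derivC f (u 0 lastc) (1 : R) d ->
  is_derivC (fun y : 'rV[R]_N => f (y 0 lastc)) u v ((v 0 lastc)%:C * d).
Proof.
move=> fd; apply: is_derivC_comp fd _ _; first exact: differentiable_coord.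
by case: (is_derive_coord u v lastc).
Qed.

Lemma is_derive_weighted (u v a : 'rV[R]_N) :
  is_derive u v (fun y => weighted y a) (weighted v a).
Proof.
apply: is_derive_bigsum => j.
have := is_deriveMr (lambda j * a 0 (lshift 1 j)) (is_derive_coord u v (lshift 1 j)).
rewrite (_ : (fun y => _) =
    fun y : 'rV[R]_N => lambda j * y 0 (lshift 1 j) * a 0 (lshift 1 j)).
  by move/is_derive_eq; apply; ring.
by apply/funext => y; ring.
Qed.

Lemma is_derive_Phi (u v : 'rV[R]_N) : param_dom I u ->
  is_derive u v Phi (ofC (Phi1 u v)).
Proof.
move=> Iu; apply: is_derive_ofC => i; case: (split_ordP i) => j ->.
  rewrite row_mxEl mxE; under eq_fun do rewrite row_mxEl !mxE.
  have := is_derivCM (is_derivC_real (is_derive_coord u v (lshift 1 j)))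
                     (is_derivC_time v (w_ode j Iu)).
  by move/is_derivC_eq; apply; rewrite mulrA -rmorphM.
rewrite row_mxEr mxE (ord1 j) eqxx mulr1n.
under eq_fun do rewrite row_mxEr !mxE eqxx mulr1n.
apply: is_derivCD; last exact: is_derivC_time (beta_ode Iu).
apply: is_derivC_real.
have dl k : is_derive u v (fun y : 'rV[R]_N => lambda k * lsubmx y 0 k ^+ 2)
    (lambda k * u 0 (lshift 1 k) * v 0 (lshift 1 k) * 2).
  have dk := is_derive_coord u v (lshift 1 k).
  have := is_deriveMr (lambda k) (is_derive_leibniz dk dk).
  rewrite (_ : (fun y => _) = fun y : 'rV[R]_N => lambda k * lsubmx y 0 k ^+ 2).
    by move/is_derive_eq; apply; ring.
  by apply/funext => y; rewrite mxE; ring.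
have := is_deriveMr (- 2^-1) (is_derive_bigsum (index_enum _) dl).
under eq_fun do rewrite mulrC.
move/is_derive_eq; apply.
by rewrite /weighted mulr_suml -sumrN; apply: eq_bigr => k _; field.
Qed.

Lemma is_derive_Phi1 (u v v' : 'rV[R]_N) : param_dom I u ->
  is_derive u v' (fun y => ofC (Phi1 y v)) (ofC (Phi2 u v v')).
Proof.
move=> Iu; apply: is_derive_ofC => i; case: (split_ordP i) => j ->.
  rewrite row_mxEl mxE; under eq_fun do rewrite row_mxEl !mxE.
  have d1 := is_derivCM (is_derivC_cst (v 0 (lshift 1 j))%:C u v')
                        (is_derivC_time v' (w_ode j Iu)).
  have d2 := is_derivCM
    (is_derivC_real (is_deriveMr (v 0 lastc) (is_derive_coord u v' (lshift 1 j))))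
    (is_derivC_time v' (wdot_deriv openI smooth_w w_ode j Iu)).
  have := is_derivCD d1 d2.
  by move/is_derivC_eq; apply; rewrite !rmorphD !rmorphM /=; ring.
rewrite row_mxEr mxE (ord1 j) eqxx mulr1n.
under eq_fun do rewrite row_mxEr !mxE eqxx mulr1n.
apply: is_derivCD.
  have := is_derivC_real (is_deriveN (is_derive_weighted u v' v)).
  move/is_derivC_eq; apply; congr ((- _)%:C).
  by apply: eq_bigr => k _; ring.
have d2 := is_derivCM (is_derivC_cst (v 0 lastc)%:C u v')
  (is_derivC_time v' (betadot_deriv w_neq0 w_ode theta_ode Iu)).
by move/is_derivC_eq: d2; apply; rewrite rmorphM /=; ring.
Qed.

Lemma partial_Phi (u : 'rV[R]_N) i : param_dom I u ->
  partial i Phi u = ofC (Phi1 u (delta_mx 0 i)).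
Proof. by move=> Iu; have [_] := is_derive_Phi (delta_mx 0 i) Iu. Qed.

Lemma partial2_Phi (u : 'rV[R]_N) i k : param_dom I u ->
  partial i (partial k Phi) u = ofC (Phi2 u (delta_mx 0 k) (delta_mx 0 i)).
Proof.
move=> Iu; have [_ <-] := is_derive_Phi1 (delta_mx 0 k) (delta_mx 0 i) Iu.
apply: near_eq_derive; apply: (near_open (open_param_dom openI) Iu) => y Iy.
exact: partial_Phi.
Qed.

Lemma row_jacobian_Phi (u : 'rV[R]_N) i : param_dom I u -> differentiable Phi u ->
  row i ('J Phi u) = ofC (Phi1 u (delta_mx 0 i)).
Proof.
by move=> Iu dPhi; rewrite rowE -deriveEjacobian // -partial_Phi.
Qed.

End Geometry.

(** * Hermitian products of the derivatives *)

Section Frame.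
Variables (R : realType) (m : nat) (lambda : 'I_m -> R) (alpha : R).
Variables (theta : angle_fun R) (w : 'I_m -> R -> R[i]).
Variable u : 'rV[R]_(m + 1).

Local Notation N := (m + 1)%N.
Local Notation E := (expi_at theta).
Local Notation lastc := (rshift m (ord0 : 'I_1)).
Local Notation s := (u 0 lastc).
Local Notation x j := (u 0 (lshift 1 j)).
Local Notation "v `_[ j ]" := (v 0 (lshift 1 j)) (at level 2, format "v `_[ j ]").
Local Notation b' := (betadot theta w s).
Local Notation w' j := (wdot lambda theta w j s).
Local Notation b'' := (betaddot lambda alpha theta w s).
Local Notation w'' j := (wddot lambda theta w j s).
Local Notation nw j := (sqnorm (w j s)).
Local Notation Phi1 := (Phi1 lambda theta w u).
Local Notation Phi2 := (Phi2 lambda alpha theta w u).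
Local Notation weighted := (weighted lambda).

Hypothesis w_neq0 : forall j, w j s != 0.
Hypothesis wddot_rel : forall j,
  w'' j * conjc (w j s) + w' j * conjc (w' j) = (lambda j)%:C * b''.

Let nw0 j : nw j != 0.
Proof. by rewrite gt_eqF // sqnorm_gt0. Qed.

Let wc0 j : conjc (w j s) != 0.
Proof. by rewrite conjc_eq0. Qed.

(** The factor by which the shifts [- lambda_j x_j] of the last coordinate enlarge
    the squared volume of the tangent vectors in the directions [x_j]. *)
Definition rho : R := 1 + \sum_j (lambda j * x j) ^+ 2 / nw j.

Lemma rho_gt0 : 0 < rho.
Proof.
rewrite ltr_pwDl // sumr_ge0 // => j _.
by rewrite divr_ge0 ?sqr_ge0 // ltW // sqnorm_gt0.
Qed.

Lemma sqnorm_wdot j : sqnorm (w' j) = lambda j ^+ 2 * sqnorm b' / nw j.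
Proof.
apply: (mulIf (nw0 j)); rewrite divfK //.
rewrite -(sqnormJ (w j s)) -sqnormM wdot_conj sqnormM; congr (_ * _).
by rewrite /sqnorm /= expr0n /= addr0.
Qed.

Lemma wconj_dot j : w j s * conjc (w' j) = (lambda j)%:C * conjc b'.
Proof.
have := congr1 (@conjc R) (wdot_conj lambda theta w j s).
by rewrite (conjcM (w' j)) (conjcM (lambda j)%:C) conjc_real conjcK mulrC.
Qed.

(** The mixed terms cancel because [w_j' * conj w_j = lambda_j * beta']; the
    hermitian products of tangent vectors are therefore real, that is, the
    symplectic form vanishes on them. *)
Lemma herm_Phi1 a c : herm (Phi1 a) (Phi1 c) =
  (\sum_j nw j * a`_[j] * c`_[j] + weighted u a * weighted u c +
   a 0 lastc * c 0 lastc * (sqnorm b' * rho))%:C.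
Proof.
rewrite /herm big_split_ord /= big_ord1 !row_mxEr !mxE eqxx !mulr1n.
set an := a 0 lastc; set cn := c 0 lastc.
rewrite (eq_bigr (fun j =>
  (nw j * a`_[j] * c`_[j] + an * cn * sqnorm b' * ((lambda j * x j) ^+ 2 / nw j))%:C
  + (lambda j * x j * a`_[j])%:C * (cn%:C * conjc b')
  + (lambda j * x j * c`_[j])%:C * (an%:C * b'))); last first.
  move=> j _; rewrite !row_mxEl !mxE.
  rewrite conjcD !(conjcM _%:C) !conjc_real.
  have e1 := wdot_conj lambda theta w j s.
  have e2 := wconj_dot j.
  have e3 : w' j * conjc (w' j) = (lambda j ^+ 2 * sqnorm b' / nw j)%:C.
    by rewrite -sqnormE sqnorm_wdot.
  have e4 : w j s * conjc (w j s) = (nw j)%:C by rewrite -sqnormE.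
  (* Expand, so as to expose the four products that the relations evaluate. *)
  transitivity ((a`_[j])%:C * (c`_[j])%:C * (w j s * conjc (w j s)) +
    (a`_[j])%:C * (x j * cn)%:C * (w j s * conjc (w' j)) +
    (c`_[j])%:C * (x j * an)%:C * (w' j * conjc (w j s)) +
    (x j * an)%:C * (x j * cn)%:C * (w' j * conjc (w' j))); first by ring.
  rewrite e1 e2 e3 e4; move: (sqnorm b') (nw j) b' (conjc b') => B n y z.
  by rewrite !expr2 !(realCD, realCM); ring.
rewrite !big_split /= -!mulr_suml.
have sC (F : 'I_m -> R) : \sum_j (F j)%:C = (\sum_j F j)%:C.
  by rewrite rmorph_sum.
rewrite !sC big_split /= -mulr_sumr -!/(weighted u _).
rewrite conjcD (conjcM _%:C) !conjc_real.
have e5 : b' * conjc b' = (sqnorm b')%:C by rewrite -sqnormE.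
rewrite /rho; move: e5; move: (sqnorm b') (\sum_j _) (\sum_j _) => B S1 S2.
by rewrite !(realCD, realCM, realCN) => <-; ring.
Qed.

(** The second fundamental form evaluated three times on the direction [s]. *)
Definition cubic_coef : R :=
  \sum_j x j ^+ 2 * complex.Im (w'' j * conjc (w' j)) + complex.Im (b'' * conjc b').

(** The second fundamental form of a Lagrangian is a symmetric cubic form. Here
    [wddot_rel] expresses the terms [Im (w_j'' conj w_j)] by [Im beta''], and these
    cancel against the last coordinate, so that only [Im beta'] and the pure [s]
    coefficient remain. *)
Lemma Im_herm_Phi2 a a' c : complex.Im (herm (Phi2 a a') (Phi1 c)) =
  complex.Im b' * (a' 0 lastc * weighted a c + a 0 lastc * weighted a' c +
                   c 0 lastc * weighted a a') +
  a 0 lastc * a' 0 lastc * c 0 lastc * cubic_coef.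
Proof.
rewrite /herm big_split_ord /= big_ord1 !row_mxEr !mxE eqxx !mulr1n.
set an := a 0 lastc; set an' := a' 0 lastc; set cn := c 0 lastc.
rewrite cImD cIm_sum.
rewrite (eq_bigr (fun j => complex.Im b' * (an' * (lambda j * a`_[j] * c`_[j]) +
    an * (lambda j * a'`_[j] * c`_[j])) +
  an * an' * complex.Im b'' * (lambda j * x j * c`_[j]) +
  an * an' * cn * (x j ^+ 2 * complex.Im (w'' j * conjc (w' j))))); last first.
  move=> j _; rewrite !row_mxEl !mxE.
  rewrite conjcD !(conjcM _%:C) !conjc_real -/an -/an' -/cn.
  have e1 := wdot_conj lambda theta w j s.
  have e3 : w' j * conjc (w' j) = (sqnorm (w' j))%:C by rewrite -sqnormE.
  have e4 : w'' j * conjc (w j s) = (lambda j)%:C * b'' - (sqnorm (w' j))%:C.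
    by rewrite -wddot_rel -e3 addrK.
  set p := _ + _ * an.
  transitivity (complex.Im ((p * c`_[j])%:C * (w' j * conjc (w j s)) +
    (p * (x j * cn))%:C * (w' j * conjc (w' j)) +
    (x j * (an * an') * c`_[j])%:C * (w'' j * conjc (w j s)) +
    (x j * (an * an') * (x j * cn))%:C * (w'' j * conjc (w' j)))).
    by congr complex.Im; rewrite !realCM; ring.
  rewrite e1 e3 e4 !(cImD, cImN, cImMr) /= /p; ring.
rewrite !big_split /= -!mulr_sumr big_split /= -!mulr_sumr.
rewrite -!/(weighted _ _).
rewrite conjcD (conjcM _%:C) !conjc_real.
rewrite /cubic_coef mulrDr; set S := \sum_j _.
have -> : complex.Im (((- weighted a a')%:C + (an * an')%:C * b'') *
    ((- weighted u c)%:C + cn%:C * conjc b')) =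
    cn * weighted a a' * complex.Im b' - an * an' * weighted u c * complex.Im b'' +
    an * an' * cn * complex.Im (b'' * conjc b').
  by rewrite !(cImM, cImD, cReM, cReD, cReJ, cImJ) /=; ring.
ring.
Qed.

Lemma cubic_coefE : cubic_coef =
  sqnorm b' * complex.Im b' *
  (- rho * (alpha + \sum_j lambda j / nw j) +
   \sum_j lambda j * (lambda j * x j) ^+ 2 / nw j ^+ 2).
Proof.
have e0 : complex.Im (b'' * conjc b') = sqnorm b' * complex.Im b' *
    - (alpha + \sum_j lambda j / nw j).
  rewrite /betaddot -/(logsum _ _ _); rewrite mulrDl -mulrA -sqnormE.
  by rewrite cImD cImMr cImJ [in X in X + _]mulrC cImMr /=; ring.
rewrite /cubic_coef e0.
rewrite (eq_bigr (fun j => sqnorm b' * complex.Im b' *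
   (- (alpha + \sum_j lambda j / nw j) * ((lambda j * x j) ^+ 2 / nw j) +
    lambda j * (lambda j * x j) ^+ 2 / nw j ^+ 2))); last first.
  move=> j _.
  have -> : w'' j * conjc (w' j) = ((lambda j / nw j)%:C) *
     ((lambda j)%:C * (b'' * conjc b') - (sqnorm (w' j))%:C * conjc b').
    have e2 : conjc (w' j) = (lambda j)%:C * conjc b' / w j s.
      by rewrite -wconj_dot mulrAC mulfV // mul1r.
    have e4 : w'' j = ((lambda j)%:C * b'' - (sqnorm (w' j))%:C) / conjc (w j s).
      by rewrite -wddot_rel -sqnormE addrK mulfK.
    rewrite e4 e2 (realCM (lambda j)) realCV (sqnormE (w j s)).
    by field; rewrite w_neq0 wc0.
  rewrite cImMr cImD cImN !cImMr e0 cImJ sqnorm_wdot.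
  by field.
rewrite -mulr_sumr -mulrDr big_split /= -mulr_sumr /rho; ring.
Qed.

End Frame.

(** * Inverse metric, determinant and mean curvature *)

Section Metric.
Variables (R : realType) (m : nat) (lambda : 'I_m -> R) (alpha : R).
Variables (theta : angle_fun R) (w : 'I_m -> R -> R[i]).
Variable u : 'rV[R]_(m + 1).

Local Notation N := (m + 1)%N.
Local Notation E := (expi_at theta).
Local Notation lastc := (rshift m (ord0 : 'I_1)).
Local Notation s := (u 0 lastc).
Local Notation x j := (u 0 (lshift 1 j)).
Local Notation "v `_[ j ]" := (v 0 (lshift 1 j)) (at level 2, format "v `_[ j ]").
Local Notation b' := (betadot theta w s).
Local Notation w' j := (wdot lambda theta w j s).
Local Notation nw j := (sqnorm (w j s)).
Local Notation Phi1 := (Phi1 lambda theta w u).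
Local Notation Phi2 := (Phi2 lambda alpha theta w u).
Local Notation weighted := (weighted lambda).
Local Notation rho := (rho lambda w u).
Local Notation delta i := (delta_mx 0 i : 'rV[R]_N).

Hypothesis w_neq0 : forall j, w j s != 0.

Let nw0 j : nw j != 0.
Proof. by rewrite gt_eqF // sqnorm_gt0. Qed.

Let rho0 : rho != 0.
Proof. by rewrite gt_eqF // rho_gt0. Qed.

Let bp0 : sqnorm b' != 0.
Proof.
rewrite gt_eqF // sqnorm_gt0 // mulf_neq0 ?E_neq0 // conjc_eq0.
by apply/prodf_neq0 => k _.
Qed.

Lemma delta_ll k j : (delta (lshift 1 k))`_[j] = (j == k)%:R.
Proof. by rewrite mxE eqxx /= eq_lshift. Qed.

Lemma delta_lr k : delta (lshift 1 k) 0 lastc = 0.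
Proof. by rewrite mxE eqxx /= eq_rlshift. Qed.

Lemma delta_rl j : (delta lastc)`_[j] = 0.
Proof. by rewrite mxE eqxx /= eq_lrshift. Qed.

Lemma delta_rr : delta lastc 0 lastc = 1.
Proof. by rewrite mxE !eqxx. Qed.

Lemma sum_deltal (F : 'I_m -> R) k : \sum_j F j * (j == k)%:R = F k.
Proof.
rewrite (bigD1 k) //= eqxx mulr1 big1 ?addr0 // => j /negbTE ->.
by rewrite mulr0.
Qed.

Lemma weighted_l a k : weighted a (delta (lshift 1 k)) = lambda k * a`_[k].
Proof.
rewrite -[RHS](sum_deltal (fun j => lambda j * a`_[j])).
by apply: eq_bigr => j _; rewrite delta_ll.
Qed.

Lemma weighted_r a : weighted a (delta lastc) = 0.
Proof. by rewrite /weighted big1 // => j _; rewrite delta_rl mulr0. Qed.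

Lemma weightedC a c : weighted a c = weighted c a.
Proof. by apply: eq_bigr => j _; ring. Qed.

Definition gram : 'M[R]_N :=
  block_mx (diag_mx (\row_j nw j) +
            (\row_j (lambda j * x j))^T *m (\row_j (lambda j * x j))) 0
           0 (sqnorm b' * rho)%:M.

Lemma gramE i k : gram i k = complex.Re (herm (Phi1 (delta i)) (Phi1 (delta k))).
Proof.
rewrite herm_Phi1 // [RHS]/=.
case: (split_ordP i) => {}i ->; case: (split_ordP k) => {}k ->.
- rewrite block_mxEul !weighted_l !delta_lr !mul0r addr0 !mxE big_ord1 !mxE.
  congr (_ + _); under eq_bigr do rewrite !delta_ll.
  rewrite sum_deltal eq_sym; case: eqVneq => [->|_]; first by rewrite mulr1 mulr1n.
  by rewrite mulr0 mulr0n.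
- rewrite block_mxEur !(ord1 k) weighted_r delta_lr mulr0 !mul0r !addr0 mxE.
  by rewrite big1 // => j _; rewrite delta_rl mulr0.
- rewrite block_mxEdl !(ord1 i) weighted_r delta_lr !(mul0r, mulr0) !addr0 mxE.
  by rewrite big1 // => j _; rewrite delta_rl mulr0 mul0r.
- rewrite block_mxEdr !(ord1 i) !(ord1 k) !weighted_r delta_rr !mul1r mul0r addr0.
  rewrite mxE eqxx mulr1n big1 ?add0r // => j _.
  by rewrite delta_rl mulr0.
Qed.

(** The upper left block is a rank one perturbation of a diagonal matrix, whose
    inverse is the Sherman-Morrison formula. *)
Definition gram_inv : 'M[R]_N :=
  block_mx (diag_mx (\row_j (nw j)^-1) - rho^-1 *:
            ((\row_j (lambda j * x j / nw j))^T *m (\row_j (lambda j * x j / nw j)))) 0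
           0 (sqnorm b' * rho)^-1%:M.

Lemma gramK : gram *m gram_inv = 1%:M.
Proof.
rewrite mulmx_block !mulmx0 !mul0mx !addr0 !add0r -scalar_mxM mulfV ?mulf_neq0 //.
rewrite [RHS]scalar_mx_block; congr block_mx.
set D := diag_mx (\row_j nw j); set D' := diag_mx (\row_j (nw j)^-1).
set y : 'rV[R]_m := \row_j (lambda j * x j).
set c : 'rV[R]_m := \row_j (lambda j * x j / nw j).
have DD' : D *m D' = 1%:M.
  rewrite mulmx_diag -diag_const_mx; congr diag_mx.
  by apply/rowP => j; rewrite !mxE mulfV.
have Dc : D *m c^T = y^T.
  by apply/colP => j; rewrite mul_diag_mx !mxE mulrC divfK.
have yD : y *m D' = c by apply/rowP => j; rewrite mul_mx_diag !mxE.
have yc : y *m c^T = (rho - 1)%:M.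
  apply/matrixP => i k; rewrite (ord1 i) (ord1 k) !mxE eqxx mulr1n.
  rewrite /rho addrAC subrr add0r.
  by apply: eq_bigr => j _; rewrite !mxE; ring.
rewrite mulmxBr !mulmxDl -!scalemxAr DD' !mulmxA Dc.
rewrite -(mulmxA y^T y D') yD -(mulmxA y^T y c^T) yc mul_mx_scalar.
rewrite -scalemxAl scalerA -scalerDl.
have -> : rho^-1 + rho^-1 * (rho - 1) = 1 by field.
by rewrite scale1r addrK.
Qed.

Lemma invmx_gram : invmx gram = gram_inv.
Proof.
have [ug _] := mulmx1_unit gramK.
by rewrite -[RHS](mulKmx ug) gramK mulmx1.
Qed.

Hypothesis wddot_rel : forall j,
  wddot lambda theta w j s * conjc (w j s) + w' j * conjc (w' j) =
  (lambda j)%:C * betaddot lambda alpha theta w s.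

(** The trace splits along the blocks of the metric. By [cubic_coefE] the [s]
    direction contributes [- alpha Im betadot] and two sums, which the trace over
    the [x_j], read off the Sherman-Morrison formula, cancels. *)
Lemma mean_curvature_Phi c :
  \sum_i \sum_k gram_inv i k *
    complex.Im (herm (Phi2 (delta k) (delta i)) (Phi1 c)) =
  - (alpha * c 0 lastc * complex.Im b').
Proof.
have T0 i k : gram_inv i k *
    complex.Im (herm (Phi2 (delta k) (delta i)) (Phi1 c)) =
  c 0 lastc * (gram_inv i k * (complex.Im b' * weighted (delta k) (delta i)
    + delta k 0 lastc * delta i 0 lastc * cubic_coef lambda alpha theta w u)).
  rewrite (Im_herm_Phi2 wddot_rel).
  case: (split_ordP i) => {}i ->; case: (split_ordP k) => {}k ->.
  - by rewrite !delta_lr; ring.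
  - by rewrite block_mxEur mxE; ring.
  - by rewrite block_mxEdl mxE; ring.
  - by rewrite (ord1 i) (ord1 k) delta_rr 2!(weightedC (delta lastc)) !weighted_r; ring.
have gur i : gram_inv (lshift 1 i) lastc = 0 by rewrite block_mxEur mxE.
have gdl k : gram_inv lastc (lshift 1 k) = 0 by rewrite block_mxEdl mxE.
under eq_bigr => i _ do under eq_bigr => k _ do rewrite T0.
under eq_bigr => i _ do rewrite -mulr_sumr.
rewrite -mulr_sumr big_split_ord /= big_ord1.
under eq_bigr => i _ do rewrite big_split_ord /= big_ord1.
rewrite big_split_ord /= big_ord1 delta_rr weighted_r.
rewrite [X in _ + (X + _)]big1 => [|k _]; last first.
  by rewrite gdl mul0r.
rewrite (eq_bigr (fun i => complex.Im b' * (lambda i / nw i -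
    rho^-1 * (lambda i * (lambda i * x i) ^+ 2 / nw i ^+ 2)))); last first.
  move=> i _; rewrite [gram_inv _ lastc]gur mul0r addr0.
  under eq_bigr => k _ do rewrite weighted_l delta_ll !delta_lr mulr0 mul0r addr0
    mulrA mulrA eq_sym.
  rewrite sum_deltal block_mxEul !mxE eqxx mulr1n big_ord1 !mxE.
  by field; rewrite rho0 nw0.
rewrite -mulr_sumr sumrB -mulr_sumr block_mxEdr mxE eqxx mulr1n cubic_coefE //.
move: (\sum_j _) (\sum_i _) => S1 S2; field.
by rewrite rho0 bp0.
Qed.

Lemma Im_herm_translation c :
  complex.Im (herm (row_mx 0 (alpha%:C)%:M) (Phi1 c)) =
  - (alpha * c 0 lastc * complex.Im b').
Proof.
rewrite /herm big_split_ord /= big_ord1 big1 => [|j _]; last first.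
  by rewrite row_mxEl mxE mul0r.
rewrite add0r !row_mxEr !mxE eqxx !mulr1n cImMr cImJ cImD cImMr /=; ring.
Qed.

(** The phase of this determinant is [E s]: eliminating the last row, with
    [w_j' / w_j] a real multiple of [beta'], leaves the product of
    [w_1 ... w_m], of [beta' = E conj (w_1 ... w_m)] and of [rho]. *)
Lemma det_Phi1 :
  \det (\matrix_(i, k) Phi1 (delta i) 0 k) =
  E s * (sqnorm (\prod_(k < m) w k s) * rho)%:C.
Proof.
pose A : 'M[R[i]]_m := diag_mx (\row_j w j s).
pose A' : 'M[R[i]]_m := diag_mx (\row_j (w j s)^-1).
pose B : 'cV[R[i]]_m := \col_j (- (lambda j * x j))%:C.
pose C : 'rV[R[i]]_m := \row_j ((x j)%:C * w' j).
have -> : \matrix_(i, k) Phi1 (delta i) 0 k = block_mx A B C b'%:M.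
  apply/matrixP => i k; rewrite mxE.
  case: (split_ordP i) => {}i ->; case: (split_ordP k) => {}k ->.
  - rewrite block_mxEul row_mxEl mxE delta_lr delta_ll mulr0 mul0r addr0 !mxE.
    by rewrite eq_sym; case: eqVneq => [->|_]; rewrite ?mul1r ?mul0r ?mulr1n ?mulr0n.
  - rewrite block_mxEur row_mxEr (ord1 k) mxE eqxx mulr1n weighted_l delta_lr.
    by rewrite mul0r addr0 mxE.
  - rewrite block_mxEdl row_mxEl (ord1 i) mxE delta_rl delta_rr mulr1.
    by rewrite mul0r add0r mxE.
  - rewrite block_mxEdr row_mxEr (ord1 i) (ord1 k) mxE eqxx mulr1n weighted_r.
    by rewrite oppr0 delta_rr mul1r add0r mxE eqxx mulr1n.
have AA' : A' *m A = 1%:M.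
  rewrite mulmx_diag -diag_const_mx; congr diag_mx.
  by apply/rowP => j; rewrite !mxE mulVf.
have -> : block_mx A B C b'%:M = block_mx 1%:M 0 (C *m A') 1%:M *m
    block_mx A B 0 (b'%:M - C *m A' *m B).
  rewrite mulmx_block !mul1mx !mul0mx !addr0 -mulmxA AA' mulmx1.
  by rewrite addrC subrK.
rewrite det_mulmx det_lblock !det1 !mul1r det_ublock det_diag det_mx11.
have -> : (b'%:M - C *m A' *m B) 0 0 = b' * rho%:C.
  rewrite !mxE eqxx mulr1n /rho realCD mulrDr mulr1; congr (_ + _).
  rewrite rmorph_sum mulr_sumr -sumrN; apply: eq_bigr => j _.
  rewrite mul_mx_diag !mxE -mulrA.
  have e := wdotE lambda theta (w_neq0 j).
  transitivity ((lambda j * x j * x j)%:C * (w' j / w j s)).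
    by rewrite realCN !realCM; ring.
  by rewrite e mulrA -realCM mulrC; congr (_ * _%:C); ring.
rewrite realCM sqnormE; under eq_bigr do rewrite mxE.
rewrite /betadot; ring.
Qed.

End Metric.

(** * The soliton *)

Section Soliton.
Variables (R : realType) (m : nat) (lambda : 'I_m -> R) (alpha : R) (I : set R).
Hypotheses (openI : open I) (itvI : is_interval I) (I_neq0 : I !=set0).
Variables (theta : angle_fun R) (w : 'I_m -> R -> R[i]) (beta : R -> R[i]).
Hypothesis smooth_w : forall j, smooth_curveC I (w j).
Hypothesis w_neq0 : forall j s, I s -> w j s != 0.
Hypothesis smooth_beta : smooth_curveC I beta.

Local Notation N := (m + 1)%N.
Local Notation E := (expi_at theta).
Local Notation lastc := (rshift m (ord0 : 'I_1)).
Local Notation betadot := (betadot theta w).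
Local Notation Phi := (Phi lambda w beta).
Local Notation L := (soliton_set I lambda w beta).
Local Notation delta i := (delta_mx 0 i : 'rV[R]_N).

Hypothesis w_ode : forall j s, I s -> is_deriveC (w j) s (wdot lambda theta w j s).
Hypothesis theta_ode : forall s, I s ->
  is_derive_angle theta s
    (alpha * complex.Im (conjc (E s) * \prod_(k < m) w k s)).
Hypothesis beta_ode : forall s, I s -> is_deriveC beta s (betadot s).

Let diffeoPhi : diffeomorphism (param_dom I) L Phi.
Proof. exact: diffeomorphism_Phi theta_ode beta_ode I_neq0. Qed.

Let diffPhi u : param_dom I u -> differentiable Phi u.
Proof.
have [g [sPhi _ _ _]] := diffeoPhi.
by apply: smooth_map_differentiable sPhi; exact: open_param_dom.
Qed.

Let row_jac u i : param_dom I u ->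
  row i ('J Phi u) = ofC (Phi1 lambda theta w u (delta i)).
Proof.
by move=> Iu; apply: (row_jacobian_Phi w_ode beta_ode) => //; exact: diffPhi.
Qed.

Let lagPhi u : param_dom I u ->
  forall i k, omega (row i ('J Phi u)) (row k ('J Phi u)) = 0.
Proof.
move=> Iu i k; rewrite !row_jac // omega_ofC herm_Phi1 ?oppr0 //.
by move=> j; exact: w_neq0.
Qed.

Let detPhi u : param_dom I u -> \det (cframe ('J Phi u)) =
  E (u 0 lastc) * (sqnorm (\prod_(k < m) w k (u 0 lastc)) * rho lambda w u)%:C.
Proof.
move=> Iu; rewrite -det_Phi1; last by move=> j; exact: w_neq0.
by congr (\det _); apply/matrixP => i k; rewrite mxE row_jac // zcoord_ofC [RHS]mxE.
Qed.

Let density_gt0 u : param_dom I u ->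
  0 < sqnorm (\prod_(k < m) w k (u 0 lastc)) * rho lambda w u.
Proof.
move=> Iu; rewrite mulr_gt0 ?rho_gt0 ?sqnorm_gt0 // => [|j]; last exact: w_neq0.
by apply/prodf_neq0 => k _; exact: w_neq0.
Qed.

Lemma soliton_lagrangian : lagrangian L.
Proof.
apply: (global_lagrangian (open_param_dom openI) diffeoPhi lagPhi).
Qed.

Lemma soliton_angle : exists2 Theta : 'rV[R]_(N + N) -> circle R,
  lagrangian_angle L Theta &
  forall x s, I s -> Theta (soliton_point lambda w beta x s) = angle_at theta s.
Proof.
have [g [_ _ gPhi _]] := diffeoPhi.
exists (fun p => angle_at theta (g p 0 lastc)).
  apply: (global_lagrangian_angle (open_param_dom openI) diffeoPhi lagPhi _
            density_gt0 detPhi).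
    by move=> u _; exact: expi_at_norm.
  by move=> u Iu; have [_ ->] := gPhi u Iu; exact: expi_circle_at.
move=> x s Is; congr (angle_at theta _).
have Iu : param_dom I (row_mx x s%:M) by rewrite /param_dom /= row_mxEr mxE eqxx mulr1n.
have := gPhi _ Iu; rewrite /Phi row_mxKl row_mxEr [s%:M _ _]mxE eqxx mulr1n.
by move=> [_ ->]; rewrite row_mxEr mxE eqxx mulr1n.
Qed.

Lemma soliton_translating :
  translating_soliton N L (ofC (row_mx (0 : 'rV_m) (alpha%:C)%:M)).
Proof.
apply: (global_translating_soliton (open_param_dom openI) diffeoPhi lagPhi _
          density_gt0 detPhi).
  by move=> u _; exact: expi_at_norm.
move=> u Iu k.
have wu j : w j (u 0 lastc) != 0 by exact: w_neq0.
have -> : metric Phi u = gram lambda theta w u.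
  apply/matrixP => i l; rewrite gramE // hermE /= -!row_jac //.
  by rewrite euclidE !mxE; apply: eq_bigr => j _; rewrite !mxE.
rewrite invmx_gram // row_jac // omega_suml.
under eq_bigr => i _ do rewrite omega_suml.
transitivity (- \sum_i \sum_j gram_inv lambda theta w u i j *
    complex.Im (herm (Phi2 lambda alpha theta w u (delta j) (delta i))
                     (Phi1 lambda theta w u (delta k)))).
  rewrite -sumrN; apply: eq_bigr => i _; rewrite -sumrN; apply: eq_bigr => j _.
  rewrite omegaZl (partial2_Phi openI smooth_w w_neq0 w_ode theta_ode beta_ode) //.
  by rewrite omega_ofC mulrN.
rewrite mean_curvature_Phi //; last first.
  by move=> j; exact: (wddot_conj openI smooth_w w_neq0 w_ode theta_ode).
by rewrite omega_ofC Im_herm_translation !opprK.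
Qed.

(** For [alpha = 0] the angle has zero derivative. *)
Lemma expi_at_cst s t : alpha = 0 -> I s -> I t -> E s = E t.
Proof.
move=> a0 Is It.
have dE r : I r -> is_derivC E r (1 : R) 0.
  move=> Ir; apply: is_derivC_eq (expi_at_deriv (theta_ode Ir)) _.
  by rewrite a0 mul0r mul0r.
apply: complexP.
  apply: (interval_derive0_cst itvI (f := fun r => complex.Re (E r))) Is It.
  by move=> r /dE[].
apply: (interval_derive0_cst itvI (f := fun r => complex.Im (E r))) Is It.
by move=> r /dE[].
Qed.

Lemma soliton_special : alpha = 0 -> special_lagrangian L.
Proof.
move=> a0; split; first exact: soliton_lagrangian.
have [s0 Is0] := I_neq0; exists (angle_at theta s0).
apply: (global_lagrangian_angle (open_param_dom openI) diffeoPhi lagPhi _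
          density_gt0 detPhi).
  by move=> u _; exact: expi_at_norm.
by move=> u Iu; rewrite expi_circle_at; exact: expi_at_cst.
Qed.

End Soliton.

Theorem theoremG (R : realType) (m : nat) (hm : (1 <= m)%N)
    (lambda : 'I_m -> R) (hlambda : forall j, lambda j != 0) (alpha : R)
    (I : set R) (hIopen : open I) (hIitv : is_interval I) (hI0 : I !=set0)
    (theta : angle_fun R) (w : 'I_m -> R -> R[i]) (beta : R -> R[i])
    (htheta_smooth : smooth_angle I theta)
    (hw_smooth : forall j, smooth_curveC I (w j))
    (hw_neq0 : forall j s, I s -> w j s != 0)
    (hbeta_smooth : smooth_curveC I beta)
    (hw : forall j s, I s ->
      is_deriveC (w j) s
        ((lambda j)%:C * expi_at theta s * conjc (\prod_(k < m | k != j) w k s)))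
    (htheta : forall s, I s ->
      is_derive_angle theta s
        (alpha * complex.Im (conjc (expi_at theta s) * \prod_(k < m) w k s)))
    (hbeta : forall s, I s ->
      is_deriveC beta s (expi_at theta s * conjc (\prod_(k < m) w k s))) :
  let L := soliton_set I lambda w beta in
  [/\ lagrangian L,
      diffeomorphic L [set: 'rV[R]_(m + 1)],
      exists2 Theta : 'rV[R]_((m + 1) + (m + 1)) -> circle R,
        lagrangian_angle L Theta &
        forall x s, I s ->
          Theta (soliton_point lambda w beta x s) = angle_at theta s,
      alpha != 0 ->
        lagrangian L /\
        translating_soliton (m + 1) L (ofC (row_mx (0 : 'rV_m) (alpha%:C)%:M)) &
      alpha = 0 -> special_lagrangian L].
Proof.
move=> L; split.
- exact: (soliton_lagrangian hIopen hIitv hI0 hw_smooth hw_neq0 hbeta_smooth hw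
            htheta hbeta).
- exact: (diffeomorphic_soliton hIopen hIitv hw_smooth hw_neq0 hbeta_smooth hw
            htheta hbeta hI0).
- exact: (soliton_angle hIopen hIitv hI0 hw_smooth hw_neq0 hbeta_smooth hw
            htheta hbeta).
- move=> _; split.
    exact: (soliton_lagrangian hIopen hIitv hI0 hw_smooth hw_neq0 hbeta_smooth hw
              htheta hbeta).
  exact: (soliton_translating hIopen hIitv hI0 hw_smooth hw_neq0 hbeta_smooth hw
            htheta hbeta).
- exact: (soliton_special hIopen hIitv hI0 hw_smooth hw_neq0 hbeta_smooth hw
            htheta hbeta).
Qed.
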